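(* Let $\mathfrak C\subseteq\mathbb{R}^{1\times\ell}\langle x,x^*\rangle$ be a full, finite right chip space, let $L\in\mathbb{R}^{\nu\times\nu}\langle x,x^*\rangle$ be a linear pencil, and let $p\in\mathfrak C^*\,\mathbb{R}\langle x,x^*\rangle_1\,\mathfrak C$ be a symmetric polynomial. Then $p(X)\succeq0$ whenever $L(X)\succeq0$ (over all tuples $X$ of real square matrices of all sizes) if and only if $p$ is of the form $$p=\sum_i^{\rm finite}p_i^*p_i+\sum_j^{\rm finite}q_j^*Lq_j+\sum_k^{\rm finite}(r_k^*\iota_k+\iota_k^*r_k)$$ where $p_i,r_k\in\mathfrak C$, $q_j\in\mathbb{R}^{\nu\times1}\mathfrak C$, and $\iota_k\in\sqrt[(L,\mathfrak C)]{\{0\}}\cap\mathbb{R}\langle x,x^*\rangle_1\mathfrak C$.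
   Context: Let $x=(x_1,\dots,x_g)$, let $\langle x,x^*\rangle$ be the free monoid on the $2g$ letters $x_1,\dots,x_g,x_1^*,\dots,x_g^*$ (the empty word is $1$), and let $\mathbb{R}\langle x,x^*\rangle$ be the free real algebra on it, with the linear involution $*$ exchanging $x_i$ and $x_i^*$ and satisfying $(pq)^*=q^*p^*$. Elements of $\mathbb{R}^{\nu\times\ell}\langle x,x^*\rangle$ are written $p=\sum_w A_w\otimes w$; $p^*=\sum_w A_w^*\otimes w^*$, where $A^*$ is the transpose; $p$ is symmetric if $p=p^*$. For a tuple $X=(X_1,\dots,X_g)$ of real $n\times n$ matrices, $p(X)=\sum_w A_w\otimes w(X)$ (Kronecker product), with $x_i\mapsto X_i$, $x_i^*\mapsto X_i^*$ (transpose), empty word $\mapsto\mathrm{Id}_n$. $\mathbb{R}\langle x,x^*\rangle_d$ is the space of polynomials of degree at most $d$. A linear pencil is a symmetric square matrix polynomial of degree at most $1$. For sets $A,B$ of matrix polynomials of compatible sizes, $AB$ is the span of all products $ab$, and $A^*=\{a^*:a\in A\}$. A left module is a left $\mathbb{R}\langle x,x^*\rangle$-submodule $I$ of $\mathbb{R}^{1\times\ell}\langle x,x^*\rangle$; $\mathbb{R}^{a\times1}I$ is the set of $a\times\ell$ matrices all of whose rows lie in $I$, and $I^*\mathbb{R}^{1\times\ell}=(\mathbb{R}^{\ell\times1}I)^*$. Monomials of $\mathbb{R}^{1\times\ell}\langle x,x^*\rangle$ are the elements $e_i\otimes w$ ($e_i$ a standard basis row vector, $w$ a word). A right chip space is a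 subspace $\mathfrak C$ spanned by monomials such that $e_i\otimes w_1w_2w_3,\ e_i\otimes w_3\in\mathfrak C$ implies $e_i\otimes w_2w_3\in\mathfrak C$; it is finite if finite dimensional, and full if for every monomial $e_i\otimes w_1w_2\in\mathfrak C$ also $e_i\otimes w_2\in\mathfrak C$. A left module $I$ is $(L,\mathfrak C)$-real if whenever $\sum_i^{\rm finite}p_i^*p_i+\sum_j^{\rm finite}q_j^*Lq_j\in\mathbb{R}^{\ell\times1}I+I^*\mathbb{R}^{1\times\ell}$ with $p_i\in\mathfrak C$, $q_j\in\mathbb{R}^{\nu\times1}\mathfrak C$, then each $p_i\in I$ and each $Lq_j\in\mathbb{R}^{\nu\times1}I$. $\sqrt[(L,\mathfrak C)]{\{0\}}$ is the smallest $(L,\mathfrak C)$-real left module in $\mathbb{R}^{1\times\ell}\langle x,x^*\rangle$. *)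

(* Defs.v *)
From HB Require Import structures.
From mathcomp Require Import all_boot all_order all_algebra finmap.
From mathcomp Require Import boolp classical_sets reals.
From mathcomp Require Import monalg mxtens.

Set Implicit Arguments.
Unset Strict Implicit.
Unset Printing Implicit Defensive.

Import Order.TTheory GRing.Theory Num.Theory.
Local Open Scope classical_set_scope.
Local Open Scope ring_scope.

(* The letter [(i, false)] is x_i and the letter [(i, true)] is x_i^*. *)
Notation ncword g := {fmonom ('I_g * bool)%type}.

Notation ncpoly R g := {malg R[ncword g]}.

(* An m x n matrix polynomial sum_w A_w (x) w is represented by the matrix over
   the free algebra whose (i, j) entry is sum_w (A_w i j) w, so that
   A_w = map_mx (mcoeff w) p. *)
Notation ncmx R g m n := 'M[ncpoly R g]_(m, n).

Section Involution.
Context {R : realType} {g : nat}.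

Definition star_letter (a : 'I_g * bool) : 'I_g * bool := (a.1, ~~ a.2).

Definition star_word (w : ncword g) : ncword g :=
  FMonom (rev (map star_letter w)).

Definition star (f : ncpoly R g) : ncpoly R g :=
  \sum_(w <- msupp f) << f@_w *g star_word w >>.

Definition adj {m n} (p : ncmx R g m n) : ncmx R g n m := (map_mx star p)^T.

Definition nc_symmetric {n} (p : ncmx R g n n) : Prop := p = adj p.

(* [mmeasure fdeg] is 1 + degree, and 0 at the zero polynomial. *)
Definition deg_le {m n} (d : nat) : set (ncmx R g m n) :=
  [set p | forall i j, (mmeasure (@fdeg _) (p i j) <= d.+1)%N].

Definition linear_pencil {n} (L : ncmx R g n n) : Prop :=
  nc_symmetric L /\ deg_le 1 L.

End Involution.

Section Evaluation.
Context {R : realType} {g : nat}.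

Definition eval_letter {n} (X : 'I_g -> 'M[R]_n) (a : 'I_g * bool) : 'M[R]_n :=
  if a.2 then (X a.1)^T else X a.1.

Definition eval_word {n} (X : 'I_g -> 'M[R]_n) (w : ncword g) : 'M[R]_n :=
  \prod_(a <- w) eval_letter X a.

Definition mx_supp {m k} (p : ncmx R g m k) : {fset ncword g} :=
  (\big[fsetU/fset0]_(i < m) \big[fsetU/fset0]_(j < k) msupp (p i j))%fset.

Definition nc_eval {m k n} (X : 'I_g -> 'M[R]_n) (p : ncmx R g m k) :
    'M[R]_(m * n, k * n) :=
  \sum_(w <- mx_supp p) (map_mx (mcoeff w) p *t eval_word X w).

Definition psdmx {n} (A : 'M[R]_n) : Prop :=
  A^T = A /\ forall u : 'cV[R]_n, 0 <= (u^T *m A *m u) 0 0.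

End Evaluation.

Section Sets.
Context {R : realType} {g : nat}.

(* Linear span over R; scaling by a real c is scaling by the constant
   polynomial c%:MP. *)
Definition rspan {m n} (S : set (ncmx R g m n)) : set (ncmx R g m n) :=
  [set v | exists (k : nat) (c : 'I_k -> R) (s : 'I_k -> ncmx R g m n),
     (forall i, S (s i)) /\ v = \sum_(i < k) (c i)%:MP *: s i].

Definition mulset {m n k} (A : set (ncmx R g m n)) (B : set (ncmx R g n k)) :
    set (ncmx R g m k) :=
  rspan [set a *m b | a in A & b in B].

Definition adjset {m n} (A : set (ncmx R g m n)) : set (ncmx R g n m) :=
  [set adj a | a in A].

(* R^{a x 1} I *)
Definition rows_in {l} (a : nat) (I : set (ncmx R g 1 l)) : set (ncmx R g a l) :=
  [set A | forall i, I (row i A)].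

End Sets.
Arguments rows_in {R g l} a I.

Section ChipSpaces.
Context {R : realType} {g l : nat}.
Implicit Type C : set (ncmx R g 1 l).

(* The monomial e_i (x) w *)
Definition monomial (i : 'I_l) (w : ncword g) : ncmx R g 1 l :=
  << w >> *: delta_mx 0 i.

Definition right_chip_space C : Prop :=
  (exists S : set ('I_l * ncword g), C = rspan [set monomial s.1 s.2 | s in S])
  /\ forall i (w1 w2 w3 : ncword g),
       C (monomial i (mmul (mmul w1 w2) w3)) -> C (monomial i w3) ->
       C (monomial i (mmul w2 w3)).

Definition full_chip C : Prop :=
  forall i (w1 w2 : ncword g),
    C (monomial i (mmul w1 w2)) -> C (monomial i w2).

Definition finite_chip C : Prop :=
  exists (k : nat) (b : 'I_k -> ncmx R g 1 l), C `<=` rspan (range b).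

End ChipSpaces.

Section Radical.
Context {R : realType} {g l nu : nat}.
Variables (L : ncmx R g nu nu) (C : set (ncmx R g 1 l)).
Implicit Type I : set (ncmx R g 1 l).

Definition left_module I : Prop :=
  I 0 /\ forall (f : ncpoly R g) u v, I u -> I v -> I (f *: u + v).

(* R^{l x 1} I + I^* R^{1 x l} *)
Definition sym_sum I : set (ncmx R g l l) :=
  [set A + B | A in rows_in l I & B in adjset (rows_in l I)].

Definition lc_real I : Prop :=
  forall (np nq : nat) (p : 'I_np -> ncmx R g 1 l) (q : 'I_nq -> ncmx R g nu l),
    (forall i, C (p i)) -> (forall j, rows_in nu C (q j)) ->
    sym_sum I (\sum_(i < np) adj (p i) *m p i
               + \sum_(j < nq) adj (q j) *m L *m q j) ->
    (forall i, I (p i)) /\ (forall j, rows_in nu I (L *m q j)).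

(* The smallest (L, C)-real left module containing A; [lc_radicalP] below shows
   that this intersection is itself an (L, C)-real left module. *)
Definition lc_radical (A : set (ncmx R g 1 l)) : set (ncmx R g 1 l) :=
  smallest [set I | left_module I /\ lc_real I] A.

Lemma lc_radicalP (A : set (ncmx R g 1 l)) :
  left_module (lc_radical A) /\ lc_real (lc_radical A).
Proof.
split; first split=> [I [[[I0 _] _] _]//|f u v Iu Iv I IP].
  by case: (IP) => -[[_ addI] _] _; apply: addI; [exact: Iu | exact: Iv].
move=> np nq p q Cp Cq [B HB [D [E HE <-] eqS]].
have realI I : (left_module I /\ lc_real I) /\ A `<=` I ->
    (forall i, I (p i)) /\ (forall j, rows_in nu I (L *m q j)).
  move=> IP; apply: IP.1.2 Cp Cq _; exists B; first by move=> i; apply: HB.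
  by exists (adj E) => //; exists E => // i; apply: HE.
by split=> [i I /realI[]|j i I /realI[_]]//; apply.
Qed.

End Radical.

(* Main.v *)
Require Import Defs.
From HB Require Import structures.
From mathcomp Require Import all_boot all_order all_algebra finmap.
From mathcomp Require Import boolp classical_sets reals.
From mathcomp Require Import ring lra.

(** Write [D] for the polynomials of degree at most one and [I] for the
[(L, C)]-radical of zero.

A certificate forces positivity because, at a tuple [X] where [L(X)] is positive
semidefinite, the rows [u] with [u(X) = 0] form an [(L, C)]-real left module
([eval_kernel_real]): a vanishing sum of positive semidefinite matrices has only
zero terms.  Hence the rows of [I] vanish at [X], and what is left of the
certificate evaluates to a sum of positive semidefinite matrices
([geval_cert_psd]).

Conversely, let [p] have no certificate.  Consider the finite dimensional space
[span_CDC], spanned by the products [a^* d b] with [a], [b] in [C] and [d] in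
[D], its subspace [null_forms], spanned by the [r^* i + i^* r] with [r] in [C] and
[i] in [I] and [D C], and the quadratic map
  [(a, q, t) |-> a^* a + q^* L q - t^2 p].
If values of this map add up to a null form, then all the arguments are trivial:
[t <> 0] would give a certificate for [p], and for [t = 0] this is the reality of
[I].  A theorem of alternatives for quadratic forms ([psd_alternative]) turns this
into a linear functional [lam] which kills the null forms and is positive at all
nontrivial arguments ([separation], [separating_functional]).  Thus
[lam (a^* a) > 0] for [a] in [C] outside [I], [lam (q^* L q) >= 0], and
[lam p < 0].  Strict positivity and separation come out of a single minimisation
over a sphere, in place of a proof that the cone of certificates is closed.

The functional makes [C / (C /\ I)] a Euclidean space, on which the letters act by
compressed multiplication; the entries of this action are values of [lam] on
[C^* D C], which is why [p] has to lie there.  This defines a tuple [X]; since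
[C] is full, each word [w] with [e_i w] in [C] maps the class of [e_i] to the
class of [e_i w] without ever leaving [C] ([eval_word_seed]).  So the quadratic
form of [L(X)] takes the values [lam (q^* L q)], and that of [p(X)] takes the value
[lam p < 0] ([gns_representation]).

All of this except the action of words needs only an involution and central
scalars, so it is carried out over an abstract star algebra. *)

Set Implicit Arguments.
Unset Strict Implicit.
Unset Printing Implicit Defensive.

Import Order.TTheory GRing.Theory Num.Theory.
Local Open Scope classical_set_scope.
Local Open Scope ring_scope.

(** * Positive semidefinite matrices *)

Lemma dotmx_ge0 (R : realDomainType) n (b : 'rV[R]_n) : 0 <= (b *m b^T) 0 0.
Proof. by rewrite mxE sumr_ge0 // => j _; rewrite mxE -expr2 sqr_ge0. Qed.

Lemma dotmx_eq0 (R : realDomainType) n (b : 'rV[R]_n) :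
  (b *m b^T) 0 0 = 0 -> b = 0.
Proof.
rewrite mxE => /eqP; rewrite psumr_eq0 => [/allP h|j _]; last first.
  by rewrite mxE -expr2 sqr_ge0.
apply/rowP => j; rewrite mxE; apply/eqP.
by have := h j; rewrite mem_index_enum mxE mulf_eq0 orbb; apply.
Qed.

(** Induction on the size by Schur complements.  If the corner entry is zero,
positivity at vectors with a large first coordinate kills the rest of the first
row. *)
Lemma psd_sqrt (R : realType) n (G : 'M[R]_n) :
  psdmx G -> exists A : 'M[R]_n, G = A^T *m A.
Proof.
elim: n G => [|n IHn]; first by move=> G _; exists 0; apply/matrixP => -[].
rewrite -[n.+1]/(1 + n)%N => G [symG posG].
set a := ulsubmx G 0 0; set b := ursubmx G; set D := drsubmx G.
have GE : G = block_mx a%:M b b^T D.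
  rewrite -[G in LHS]submxK -mx11_scalar; congr block_mx.
  by rewrite /b trmx_ursub symG.
have symD : D^T = D by rewrite /D trmx_drsub symG.
have posE (t : R) (w : 'cV[R]_n) :
    0 <= a * t ^+ 2 + 2 * t * (b *m w) 0 0 + (w^T *m D *m w) 0 0.
  have := posG (col_mx t%:M w).
  rewrite GE tr_col_mx mul_row_block mul_row_col !mulmxDl tr_scalar_mx.
  rewrite -!scalar_mxM mul_scalar_mx -scalemxAl.
  have -> : w^T *m b^T = (b *m w)^T by rewrite trmx_mul.
  rewrite mul_mx_scalar !mxE /= !mulr1n; set q := (\sum_j _ * w j 0); set x := \sum_j _.
  lra.
have a_ge0 : 0 <= a.
  by have := posE 1 0; rewrite !mulmx0 !mxE; lra.
have [a0|a_neq0] := eqVneq a 0.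
  have b0 : b = 0.
    apply: dotmx_eq0; set c := (_ *m _) 0 0.
    apply/eqP; apply: contraT => c_neq0.
    (* A first coordinate for which the linear term outweighs the constant term. *)
    have := posE (- (1 + (b *m D *m b^T) 0 0) / (2 * c)) b^T.
    rewrite trmxK -/c a0 mul0r add0r.
    have -> : 2 * (- (1 + (b *m D *m b^T) 0 0) / (2 * c)) * c
       = - (1 + (b *m D *m b^T) 0 0) by field.
    by lra.
  have [|A' DE] := IHn D.
    by split=> // w; have := posE 0 w; rewrite a0; lra.
  exists (block_mx 0 0 0 A' : 'M_(1 + n)).
  rewrite GE a0 b0 tr_block_mx mulmx_block !trmx0 !mul0mx !mulmx0 !add0r DE.
  by rewrite raddf0.
have a_gt0 : 0 < a by rewrite lt0r a_neq0.
have [|A' DE] := IHn (D - a^-1 *: (b^T *m b)).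
  split; first by rewrite linearB /= linearZ /= trmx_mul trmxK symD.
  (* The first coordinate that minimises the quadratic form leaves the Schur
     complement. *)
  move=> w; have := posE (- (b *m w) 0 0 / a) w.
  have -> : w^T *m (D - a^-1 *: (b^T *m b)) *m w
      = w^T *m D *m w - a^-1 *: ((b *m w)^T *m (b *m w)).
    by rewrite trmx_mul mulmxBr mulmxBl -scalemxAr -scalemxAl !mulmxA.
  move: (b *m w) => x h; rewrite mxE.
  have -> : (- (a^-1 *: (x^T *m x))) 0 0 = - (a^-1 * (x 0 0 * x 0 0)).
    by rewrite !mxE big_ord1 mxE.
  move: h; congr (_ <= _); rewrite addrC; congr (_ + _).
  by field.
have sa : Num.sqrt a ^+ 2 = a by rewrite sqr_sqrtr.
have sa0 : Num.sqrt a != 0 by rewrite sqrtr_eq0 -ltNge.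
exists (block_mx (Num.sqrt a)%:M ((Num.sqrt a)^-1 *: b) 0 A' : 'M_(1 + n)).
rewrite GE tr_block_mx mulmx_block !trmx0 !mulmx0 !mul0mx !addr0 -DE.
rewrite tr_scalar_mx -scalar_mxM -expr2 sa mul_scalar_mx scalerA divff // scale1r.
rewrite linearZ /= mul_mx_scalar scalerA divff // scale1r -scalemxAl -scalemxAr scalerA.
by rewrite -expr2 exprVn sa addrC subrK.
Qed.

Section Psd.
Context {R : realType}.

Lemma psdmx0 n : psdmx (0 : 'M[R]_n).
Proof. by split=> [|u]; rewrite ?trmx0 // mulmx0 mul0mx mxE. Qed.

Lemma psdmxD n (A B : 'M[R]_n) : psdmx A -> psdmx B -> psdmx (A + B).
Proof.
move=> [sA pA] [sB pB]; split; first by rewrite linearD /= sA sB.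
by move=> u; rewrite mulmxDr mulmxDl mxE addr_ge0.
Qed.

Lemma psdmx_sum n (I : finType) (F : I -> 'M[R]_n) :
  (forall i, psdmx (F i)) -> psdmx (\sum_i F i).
Proof.
by move=> pF; elim/big_ind: _ => //; [exact: psdmx0 | exact: psdmxD].
Qed.

Lemma psdmx_conj m n (A : 'M[R]_n) (B : 'M[R]_(n, m)) :
  psdmx A -> psdmx (B^T *m A *m B).
Proof.
move=> [sA pA]; split; first by rewrite !trmx_mul trmxK sA mulmxA.
by move=> u; have := pA (B *m u); rewrite trmx_mul !mulmxA.
Qed.

Lemma psdmx1 n : psdmx (1%:M : 'M[R]_n).
Proof.
split=> [|u]; first exact: trmx1.
by rewrite mulmx1 mxE sumr_ge0 // => i _; rewrite mxE -expr2 sqr_ge0.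
Qed.

Lemma psdmx_gram m n (B : 'M[R]_(n, m)) : psdmx (B^T *m B).
Proof. by have := psdmx_conj B (psdmx1 n); rewrite mulmx1. Qed.

Lemma mxtrace_gram m n (B : 'M[R]_(m, n)) :
  \tr (B^T *m B) = \sum_j \sum_i B i j ^+ 2.
Proof. by apply: eq_bigr => j _; rewrite mxE; apply: eq_bigr => i _; rewrite mxE. Qed.

Lemma mxtrace_gram_eq0 m n (B : 'M[R]_(m, n)) : \tr (B^T *m B) = 0 -> B = 0.
Proof.
have ge0 i j : 0 <= B i j ^+ 2 by exact: sqr_ge0.
move=> /eqP; rewrite mxtrace_gram psumr_eq0 => [/allP B0|j _]; last exact: sumr_ge0.
apply/matrixP => i j; rewrite mxE; apply/eqP.
have := B0 j; rewrite mem_index_enum psumr_eq0 // => /(_ isT)/allP/(_ i).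
by rewrite mem_index_enum sqrf_eq0; apply.
Qed.

(** The traces are nonnegative and add up to zero, and a Gram matrix of trace zero
vanishes. *)
Lemma psdmx_sum_eq0 n (I : finType) (F : I -> 'M[R]_n) :
  (forall i, psdmx (F i)) -> \sum_i F i = 0 -> forall i, F i = 0.
Proof.
move=> pF F0 i.
have trF j : 0 <= \tr (F j).
  have [A ->] := psd_sqrt (pF j).
  by rewrite mxtrace_gram !sumr_ge0 // => k _; rewrite sumr_ge0 // => ? _; exact: sqr_ge0.
have /eqP : \sum_j \tr (F j) = 0 by rewrite -raddf_sum F0 raddf0.
rewrite psumr_eq0 // => /allP/(_ i); rewrite mem_index_enum => /(_ isT)/eqP.
have [A ->] := psd_sqrt (pF i).
by move=> /mxtrace_gram_eq0 ->; rewrite mulmx0.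
Qed.

Lemma psdmx_conj_eq0 m n (A : 'M[R]_n) (B : 'M[R]_(n, m)) :
  psdmx A -> B^T *m A *m B = 0 -> A *m B = 0.
Proof.
move=> /psd_sqrt[C ->] CB0.
have : \tr ((C *m B)^T *m (C *m B)) = 0.
  by rewrite trmx_mul -(mxtrace0 R m) -CB0 !mulmxA.
by move=> /mxtrace_gram_eq0 CB; rewrite -mulmxA CB mulmx0.
Qed.

End Psd.

(** * A theorem of alternatives for quadratic forms *)

Module Compactness.
From mathcomp Require Import topology normedtype derive.
Import numFieldNormedType.Exports.
Lemma continuous_sum (R : realType) (I : finType) (T : topologicalType) (F : I -> T -> R) :
  (forall i, continuous (F i)) -> continuous (fun v => \sum_i F i v).
Proof. by move=> cF; apply: continuous_big => //; exact: add_continuous. Qed.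

Lemma continuous_sqnorm (R : realType) n :
  continuous (fun v : 'rV[R]_n => \sum_i v 0 i * v 0 i).
Proof.
apply: continuous_sum => i v.
apply: continuousM; apply: coord_continuous.
Qed.

Lemma sphere_min (R : realType) n (f : 'rV[R]_n -> R) (u : 'rV[R]_n) :
    continuous f -> \sum_i u 0 i * u 0 i = 1 ->
  exists2 v : 'rV[R]_n, \sum_i v 0 i * v 0 i = 1 &
    forall w : 'rV[R]_n, \sum_i w 0 i * w 0 i = 1 -> f v <= f w.
Proof.
move=> cf u1; pose S := [set v : 'rV[R]_n | \sum_i v 0 i * v 0 i = 1].
have S0 : S !=set0 by exists u.
have clS : closed S.
  rewrite (_ : S = (fun v => \sum_i v 0 i * v 0 i) @^-1` [set 1]) //.
  by apply: (preimage_closed _ (@closed_eq _ _)) => v _; exact: continuous_sqnorm.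
have boS : bounded_set S.
  exists 1; split=> // M M1 v /= vS; apply: le_trans (ltW M1).
  rewrite /Num.norm /= mx_normrE; apply/bigmax_leP; split=> // -[i j] _ /=.
  rewrite (ord1 i) -(@ler_pXn2r _ 2%N) ?nnegrE // expr1n real_normK ?num_real //.
  rewrite -vS (bigD1 j) //= -expr2 lerDl sumr_ge0 // => k _.
  by rewrite -expr2 sqr_ge0.
have [v vS vmin] := EVT_min_rV S0 (bounded_closed_compact boS clS) (continuous_subspaceT cf).
exists v; first by rewrite inE in vS.
by move=> w wS; apply: vmin; rewrite inE.
Qed.

Lemma tr_mxvec (R : realType) n (v : 'rV[R]_(n * n)) :
  \tr ((vec_mx v)^T *m vec_mx v) = \sum_i v 0 i * v 0 i.
Proof.
rewrite mxtrace_mulC (reindex _ (curry_mxvec_bij n n)) /=.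
transitivity (\sum_(p : 'I_n * 'I_n)
    v 0 (mxvec_index p.1 p.2) * v 0 (mxvec_index p.1 p.2)); last first.
  by apply: eq_bigr => -[i j] _.
rewrite -(pair_bigA _ (fun i j => v 0 (mxvec_index i j) * v 0 (mxvec_index i j))) /=.
by apply: eq_bigr => i _; rewrite mxE; apply: eq_bigr => j _; rewrite !mxE.
Qed.

Lemma continuous_quad (R : realType) n (B : 'M[R]_n) :
  continuous (fun v : 'rV[R]_(n * n) => \tr (vec_mx v *m B *m (vec_mx v)^T)).
Proof.
rewrite (_ : (fun v : 'rV[R]_(n * n) => _) = (fun v : 'rV[R]_(n * n) => \sum_i \sum_j
    (\sum_k v 0 (mxvec_index i k) * B k j) * v 0 (mxvec_index i j))).
  apply: continuous_sum => i; apply: continuous_sum => j v.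
  apply: continuousM; last exact: coord_continuous.
  move: v; apply: continuous_sum => k v.
  by apply: continuousM; [exact: coord_continuous | exact: cst_continuous].
apply/funext => v; apply: eq_bigr => i _; rewrite mxE; apply: eq_bigr => j _.
by rewrite !mxE; congr (_ * _); apply: eq_bigr => k _; rewrite mxE.
Qed.

(** Theorem of alternatives: either some nonzero positive semidefinite [A^T A] is
orthogonal to all the [B k], or a linear combination of the [B k] is positive
definite.  On the compact sphere [tr (A^T A) = 1], minimise the squared norm of
the vector of all [tr (A (B k) A^T)]; the vector at a minimum consists of the
coefficients of the combination, since moving from [A^T A] towards a rank one
matrix [u^T u] would decrease the norm if the combination were not positive
at [u]. *)
Lemma psd_alternative (R : realType) n m (B : 'I_m -> 'M[R]_n) :
    (forall A : 'M[R]_n, (forall k, \tr (A *m B k *m A^T) = 0) -> A = 0) ->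
  exists c : 'I_m -> R, forall u : 'rV[R]_n, u != 0 ->
    0 < \sum_k c k * (u *m B k *m u^T) 0 0.
Proof.
move=> noA.
have nrm (u : 'rV[R]_n) : u != 0 -> exists2 G : 'M[R]_n, psdmx G /\ \tr G = 1 &
   exists2 a, 0 < a & forall k, \tr (G *m B k) = a * (u *m B k *m u^T) 0 0.
  move=> u0; pose a : R := (u *m u^T) 0 0.
  have a_gt0 : 0 < a.
    by rewrite lt0r dotmx_ge0 andbT; apply: contra_neq u0; exact: dotmx_eq0.
  have trE (M : 'M[R]_n) : \tr (a^-1 *: (u^T *m u) *m M) = a^-1 * (u *m M *m u^T) 0 0.
    by rewrite -scalemxAl mxtraceZ mxtrace_mulC mulmxA mxtrace_mulC mulmxA trace_mx11.
  exists (a^-1 *: (u^T *m u)); last by exists a^-1; rewrite ?invr_gt0.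
  split; last by rewrite -[X in \tr X]mulmx1 trE mulmx1 mulVf ?gt_eqF.
  split; first by rewrite linearZ /= trmx_mul trmxK.
  move=> w; rewrite -scalemxAr -scalemxAl mulmxA -(mulmxA _ u).
  have -> : w^T *m u^T = (u *m w)^T by rewrite trmx_mul.
  rewrite !mxE big_ord1 mxE mulr_ge0 ?invr_ge0 ?(ltW a_gt0) //.
  by rewrite -expr2 sqr_ge0.
have sqrtG (G : 'M[R]_n) : psdmx G -> \tr G = 1 ->
    exists2 v : 'rV[R]_(n * n), \sum_i v 0 i * v 0 i = 1 &
    G = (vec_mx v)^T *m vec_mx v.
  move=> /psd_sqrt[A ->] trA; exists (mxvec A); last by rewrite mxvecK.
  by rewrite -tr_mxvec mxvecK.
have [[u0 /nrm[G0 [psd0 tr0] _]]|nou] := pselect (exists u : 'rV[R]_n, u != 0); last first.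
  by exists (fun=> 0) => u u0; case: nou; exists u.
have [v0 v0S _] := sqrtG _ psd0 tr0.
pose t (v : 'rV[R]_(n * n)) k := \tr (vec_mx v *m B k *m (vec_mx v)^T).
pose f v := \sum_k t v k * t v k.
have cf : continuous f.
  apply: continuous_sum => k v.
  by apply: (@continuousM R _ (t^~ k) (t^~ k)); exact: (@continuous_quad R n (B k)).
have [v vS vmin] := sphere_min cf v0S.
exists (t v) => u /nrm[G [psdG trG] [a a_gt0 GB]].
have Tpos : 0 < f v.
  rewrite lt0r sumr_ge0 ?andbT => [|k _]; last by rewrite -expr2 sqr_ge0.
  apply/eqP => /eqP; rewrite psumr_eq0 => [/allP t0|k _]; last by rewrite -expr2 sqr_ge0.
  have v_eq0 : vec_mx v = 0.
    apply: noA => k; have := t0 k; rewrite mem_index_enum mulf_eq0 orbb.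
    by move=> /(_ isT)/eqP.
  move: vS; rewrite -tr_mxvec v_eq0 mulmx0 mxtrace0 => /eqP.
  by rewrite eq_sym oner_eq0.
pose S := \sum_k t v k * \tr (G *m B k).
have -> : \sum_k t v k * (u *m B k *m u^T) 0 0 = a^-1 * S.
  rewrite mulr_sumr; apply: eq_bigr => k _.
  by rewrite GB mulrCA mulKf ?gt_eqF.
rewrite mulr_gt0 ?invr_gt0 //.
pose Q := \sum_k \tr (G *m B k) * \tr (G *m B k).
have Q_ge0 : 0 <= Q by rewrite sumr_ge0 // => k _; rewrite -expr2 sqr_ge0.
have minE s : 0 <= s -> s <= 1 ->
    f v <= (1 - s) ^+ 2 * f v + 2 * s * (1 - s) * S + s ^+ 2 * Q.
  move=> s0 s1.
  (* A convex combination of two points of trace one is again [A^T A] for a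
     square [A], hence comes from a point of the sphere. *)
  pose H := (1 - s) *: ((vec_mx v)^T *m vec_mx v) + s *: G.
  have psdH : psdmx H.
    case: psdG => symG posG.
    split; first by rewrite linearD !linearZ /= trmx_mul trmxK symG.
    move=> w; rewrite mulmxDr mulmxDl -!scalemxAr -!scalemxAl [X in 0 <= X]mxE.
    have -> : w^T *m ((vec_mx v)^T *m vec_mx v) *m w
       = (w^T *m (vec_mx v)^T) *m (w^T *m (vec_mx v)^T)^T.
      by rewrite trmx_mul !trmxK !mulmxA.
    rewrite [X in 0 <= X + _]mxE [X in 0 <= _ + X]mxE.
    by rewrite addr_ge0 // mulr_ge0 ?subr_ge0 // dotmx_ge0.
  have trH : \tr H = 1.
    by rewrite mxtraceD !mxtraceZ tr_mxvec vS trG !mulr1 subrK.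
  have [w wS HE] := sqrtG _ psdH trH.
  have := vmin _ wS; congr (_ <= _).
  rewrite /f /S /Q !mulr_sumr -!big_split /=; apply: eq_bigr => k _.
  have tE x : t x k = \tr ((vec_mx x)^T *m vec_mx x *m B k).
    by rewrite /t mxtrace_mulC mulmxA.
  have -> : t w k = (1 - s) * t v k + s * \tr (G *m B k).
    by rewrite !tE -HE mulmxDl mxtraceD -!scalemxAl !mxtraceZ.
  by move: (t v k) (\tr _) => x y; ring.
rewrite ltNge; apply/negP => S_le0.
have TQ : 0 < f v + Q by rewrite ltr_wpDr.
(* For this step the term quadratic in [s] is half of the linear one. *)
pose s := f v / (f v + Q).
have s0 : 0 < s by rewrite divr_gt0.
have s1 : s <= 1 by rewrite ler_pdivrMr // mul1r lerDl.
have sE : s * (f v + Q) = f v by rewrite mulfVK ?gt_eqF.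
have := minE s (ltW s0) s1.
have : 2 * s * (1 - s) * S <= 0.
  by rewrite mulr_ge0_le0 // mulr_ge0 ?subr_ge0 // mulr_ge0 // ltW.
have : s * (s * (f v + Q)) = s * f v by rewrite sE.
have : 0 < s * f v by rewrite mulr_gt0.
move: (2 * s * (1 - s) * S) => x; rewrite !expr2; lra.
Qed.
End Compactness.

From mathcomp Require Import monalg mxtens.

(** * Finitely generated subspaces *)

Section Subspaces.
Context {R : realType}.

Definition subspace (V : lmodType R) (S : set V) : Prop :=
  S 0 /\ forall (c : R) u v, S u -> S v -> S (c *: u + v).

Definition fin_gen (V : lmodType R) (S : set V) : Prop :=
  exists (k : nat) (b : 'I_k -> V),
    forall v, S v -> exists c : 'I_k -> R, v = \sum_i c i *: b i.

Lemma subspaceZ (V : lmodType R) (S : set V) c v :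
  subspace S -> S v -> S (c *: v).
Proof. by move=> [S0 SD] Sv; rewrite -[_ *: _]addr0; exact: SD. Qed.

Lemma subspaceD (V : lmodType R) (S : set V) u v :
  subspace S -> S u -> S v -> S (u + v).
Proof. by move=> [S0 SD] Su Sv; rewrite -[u]scale1r; exact: SD. Qed.

Lemma subspaceB (V : lmodType R) (S : set V) u v :
  subspace S -> S u -> S v -> S (u - v).
Proof.
move=> sS Su Sv; apply: subspaceD => //.
by rewrite -scaleN1r; exact: subspaceZ.
Qed.

Lemma subspace_sum (V : lmodType R) (S : set V) {I : Type} {r : seq I} {P : pred I} {F} :
  subspace S -> (forall i, P i -> S (F i)) -> S (\sum_(i <- r | P i) F i).
Proof.
by move=> sS SF; elim/big_ind: _ => //; [case: sS | move=> u v; exact: subspaceD].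
Qed.

Lemma subspaceX (V1 V2 : lmodType R) (S1 : set V1) (S2 : set V2) :
  subspace S1 -> subspace S2 -> subspace (S1 `*` S2).
Proof.
move=> [z1 D1'] [z2 D2]; split=> [|c [u1 u2] [v1 v2] [Su1 Su2] [Sv1 Sv2]].
  by split.
by split; [exact: D1' | exact: D2].
Qed.

End Subspaces.

Lemma linear_at0 (R : realType) (U V : lmodType R) (f : U -> V) :
  linear f -> f 0 = 0.
Proof. by move=> lf; have := lf (-1) 0 0; rewrite scaler0 addr0 scaleN1r addNr. Qed.

Section Span.
Context {R : realType} {V : lmodType R}.

Definition span (T : finType) (b : T -> V) : set V :=
  [set v | exists c : T -> R, v = \sum_i c i *: b i].

Lemma span_subspace (T : finType) (b : T -> V) : subspace (span b).
Proof.
split; first by exists (fun=> 0); rewrite big1 // => i _; rewrite scale0r.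
move=> c _ _ [d ->] [e ->]; exists (fun i => c * d i + e i).
rewrite scaler_sumr -big_split /=; apply: eq_bigr => i _.
by rewrite scalerDl scalerA.
Qed.

Lemma mem_span (T : finType) (b : T -> V) i : span b (b i).
Proof.
exists (fun j => (j == i)%:R); rewrite (bigD1 i) //= eqxx scale1r big1 ?addr0 //.
by move=> j /negPf->; rewrite scale0r.
Qed.

Lemma fin_gen_span (T : finType) (b : T -> V) (S : set V) :
  S `<=` span b -> fin_gen S.
Proof.
move=> Sb; exists #|T|, (fun i => b (enum_val i)) => v /Sb[c ->].
exists (fun i => c (enum_val i)).
rewrite (reindex (fun i : 'I_#|T| => enum_val i)) //=.
by exists enum_rank => i _; rewrite ?enum_valK ?enum_rankK.
Qed.

Lemma fin_gen_span_ord (S : set V) : fin_gen S ->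
  exists (k : nat) (b : 'I_k -> V), S `<=` span b.
Proof. by move=> [k [b Sb]]; exists k, b => v /Sb. Qed.

End Span.

Lemma fin_genX (R : realType) (V1 V2 : lmodType R) (S1 : set V1) (S2 : set V2) :
  fin_gen S1 -> fin_gen S2 -> fin_gen (S1 `*` S2).
Proof.
move=> [k1 [b1 S1b]] [k2 [b2 S2b]].
pose b (i : 'I_k1 + 'I_k2) : (V1 * V2)%type :=
  match i with inl i => (b1 i, 0) | inr i => (0, b2 i) end.
apply: (@fin_gen_span _ _ _ b) => -[v1 v2] [/= /S1b[c1 ->] /S2b[c2 ->]].
exists (fun i => match i with inl i => c1 i | inr i => c2 i end).
rewrite big_sumType /=.
have f1 (c : R) (x : V1) (y : V2) : c *: (x, y) = (c *: x, c *: y) by [].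
rewrite (eq_bigr (fun i => (c1 i *: b1 i, 0))); last by move=> i _; rewrite f1 scaler0.
rewrite [X in _ + X](eq_bigr (fun i => (0, c2 i *: b2 i))); last first.
  by move=> i _; rewrite f1 scaler0.
have s1 : \sum_i (c1 i *: b1 i, 0 : V2) = (\sum_i c1 i *: b1 i, 0).
  by elim/big_rec2: _ => // i x y _ ->; rewrite -[LHS]/(_, _) /= addr0.
have s2 : \sum_i (0 : V1, c2 i *: b2 i) = (0, \sum_i c2 i *: b2 i).
  by elim/big_rec2: _ => // i x y _ ->; rewrite -[LHS]/(_, _) /= addr0.
by rewrite s1 s2 -[RHS]/(_, _) /= addr0 add0r.
Qed.

Section LinearSpan.
Context {R : realType} {V : lmodType R}.

Definition lspan (S : set V) : set V :=
  [set v | exists (k : nat) (c : 'I_k -> R) (s : 'I_k -> V),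
     (forall i, S (s i)) /\ v = \sum_(i < k) c i *: s i].

Lemma lspan_min (S T : set V) : subspace T -> S `<=` T -> lspan S `<=` T.
Proof.
move=> sT ST v [k [c [s [Ss ->]]]].
by apply: (subspace_sum sT) => i _; apply: (subspaceZ _ sT); exact: ST.
Qed.

Lemma sub_lspan (S : set V) : S `<=` lspan S.
Proof.
move=> v Sv; exists 1%N, (fun=> 1), (fun=> v); split=> //.
by rewrite big_ord1 scale1r.
Qed.

Lemma lspan_subspace (S : set V) : subspace (lspan S).
Proof.
split; first by exists 0%N, (fun=> 0), (fun=> 0); rewrite big_ord0; split=> // -[].
move=> c _ _ [k [d [s [Ss ->]]]] [k' [d' [s' [Ss' ->]]]].
exists (k + k')%N, (fun i => match split i with inl i => c * d i | inr i => d' i end),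
  (fun i => match split i with inl i => s i | inr i => s' i end).
split; first by move=> i; case: split.
rewrite big_split_ord /=; congr (_ + _).
  rewrite scaler_sumr; apply: eq_bigr => i _.
  by rewrite (unsplitK (inl i)) scalerA.
by apply: eq_bigr => i _; rewrite (unsplitK (inr i)).
Qed.

Lemma preim_subspace (W : lmodType R) (f : V -> W) (S : set W) :
  linear f -> subspace S -> subspace (f @^-1` S).
Proof.
move=> lf [S0 SD]; split=> [|c u v Su Sv]; rewrite /preimage /=.
  by rewrite linear_at0.
by rewrite lf; exact: SD.
Qed.

End LinearSpan.

Section FiniteGeneration.
Context {R : realType}.

Lemma fin_gen_bilin (V1 V2 V3 : lmodType R) (f : V1 -> V2 -> V3)
    (S1 : set V1) (S2 : set V2) (T : set V3) :
    (forall v, linear (f v)) -> (forall v, linear (f^~ v)) ->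
    fin_gen S1 -> fin_gen S2 ->
    T `<=` [set f a b | a in S1 & b in S2] -> fin_gen T.
Proof.
move=> fr fl /fin_gen_span_ord[j [a Sa]] /fin_gen_span_ord[j' [b Sb]] Tf.
pose ab (i : 'I_j * 'I_j') : V3 := f (a i.1) (b i.2).
have sS := span_subspace ab.
apply: (@fin_gen_span _ _ _ ab) => _ /Tf[x /Sa[c ->] [y /Sb[d ->] <-]].
have sub1 i' : subspace (f^~ (b i') @^-1` span ab) by exact: preim_subspace.
have sub2 x' : subspace (f x' @^-1` span ab) by exact: preim_subspace.
apply: (subspace_sum (sub2 _)) => i' _; apply: (subspaceZ _ (sub2 _)).
apply: (subspace_sum (sub1 i')) => i _; apply: (subspaceZ _ (sub1 i')).
exact: (mem_span ab (i, i')).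
Qed.

Lemma fin_gen_lspan (V : lmodType R) (T : set V) : fin_gen T -> fin_gen (lspan T).
Proof.
move=> /fin_gen_span_ord[k [b Tb]]; apply: (@fin_gen_span _ _ _ b).
by apply: lspan_min => //; exact: span_subspace.
Qed.

Lemma fin_gen_image (V1 V2 : lmodType R) (f : V1 -> V2) (T : set V1) :
  linear f -> fin_gen T -> fin_gen (f @` T).
Proof.
move=> lf /fin_gen_span_ord[k [b Tb]].
pose fb i := f (b i); have sS := span_subspace fb.
apply: (@fin_gen_span _ _ _ fb) => _ [_ /Tb[c ->] <-].
have sub := preim_subspace lf sS.
apply: (subspace_sum sub) => i _; apply: (subspaceZ _ sub).
exact: (mem_span fb i).
Qed.

(** A maximal family in [S] that is linearly independent modulo [I]; its size is
bounded because [S] is finitely generated. *)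
Lemma basis_mod (V : lmodType R) (S I : set V) :
    subspace S -> fin_gen S -> subspace I ->
  exists (n : nat) (e : 'I_n -> V),
    [/\ forall i, S (e i),
        forall c : 'I_n -> R, I (\sum_i c i *: e i) -> forall i, c i = 0
      & forall a, S a -> exists c : 'I_n -> R, I (a - \sum_i c i *: e i)].
Proof.
move=> sS [k [b bS]] sI.
pose indep n (e : 'I_n -> V) := (forall i, S (e i)) /\
  forall c : 'I_n -> R, I (\sum_i c i *: e i) -> forall i, c i = 0.
pose P n := `[<exists e : 'I_n -> V, indep n e>].
have P0 : exists n, P n.
  exists 0%N; apply/asboolP; exists (fun=> 0); split; first by case.
  by move=> c _ [].
have Pk n : P n -> (n <= k)%N.
  move=> /asboolP[e [Se eI]]; rewrite leqNgt; apply/negP => ltkn.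
  have /choice[A AE] i : exists c : 'I_k -> R, e i = \sum_j c j *: b j.
    by have [c ce] := bS _ (Se i); exists c.
  pose M := \matrix_(i, j) A i j.
  have : kermx M != 0.
    by rewrite kermx_eq0 /row_free neq_ltn (leq_ltn_trans (rank_leq_col M)).
  move=> /rowV0Pn[c /sub_kermxP cM c0].
  have : \sum_i c 0 i *: e i = 0.
    under eq_bigr do rewrite AE scaler_sumr.
    rewrite exchange_big big1 // => j _.
    under eq_bigr do rewrite scalerA.
    rewrite -scaler_suml (_ : \sum_i _ = (c *m M) 0 j).
      by rewrite cM mxE scale0r.
    by rewrite mxE; apply: eq_bigr => i _; rewrite mxE.
  move=> ce0; have cI : I (\sum_i c 0 i *: e i) by rewrite ce0; case: sI.
  by move/eqP: c0; apply; apply/rowP => i; rewrite mxE (eI _ cI).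
case: (ex_maxnP P0 Pk) => n /asboolP[e [Se eI]] nmax.
exists n, e; split=> // a Sa; apply: contrapT => noc.
suff /nmax : P n.+1 by rewrite ltnn.
apply/asboolP; exists (fun i => oapp e a (unlift ord0 i)); split.
  by move=> i /=; case: unliftP => [j|] _ /=.
move=> c; rewrite big_ord_recl unlift_none /=.
under eq_bigr do rewrite liftK /=.
move=> cI.
have c0 : c ord0 = 0.
  apply: contrapT => /eqP c0; apply: noc.
  exists (fun i => - (c ord0)^-1 * c (lift ord0 i)).
  have := subspaceZ (c ord0)^-1 sI cI.
  rewrite scalerDr scalerA mulVf // scale1r scaler_sumr.
  congr (I (_ + _)); rewrite -sumrN; apply: eq_bigr => i _.
  by rewrite scalerA mulNr scaleNr opprK.
have cI' : forall i, c (lift ord0 i) = 0.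
  by apply: eI; move: cI; rewrite c0 scale0r add0r.
by move=> i; case: (unliftP ord0 i) => [j|] ->.
Qed.

(** The coordinates on [S / I], chosen on all of [V] but linear on [S] only. *)
Lemma quotient_coord (V : lmodType R) (S I : set V) :
    subspace S -> fin_gen S -> subspace I ->
  exists (n : nat) (co : V -> 'I_n -> R),
    (forall c a b i, S a -> S b -> co (c *: a + b) i = c * co a i + co b i)
    /\ forall a, S a -> (I a <-> forall i, co a i = 0).
Proof.
move=> sS fS sI; have [n [e [Se eI eS]]] := basis_mod sS fS sI.
have /choice[co coE] a : exists c : 'I_n -> R, S a -> I (a - \sum_i c i *: e i).
  have [/eS[c cE]|nSa] := pselect (S a); first by exists c.
  by exists (fun=> 0).
exists n, co; split.
  move=> c a b i Sa Sb; apply/eqP; rewrite -subr_eq0; apply/eqP.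
  apply: (eI (fun i => co (c *: a + b) i - (c * co a i + co b i))).
  rewrite (_ : \sum_i _ = c *: (a - \sum_i co a i *: e i)
     + (b - \sum_i co b i *: e i)
     - (c *: a + b - \sum_i co (c *: a + b) i *: e i)); last first.
    under eq_bigr do rewrite scalerBl scalerDl -scalerA.
    rewrite sumrB big_split /= -scaler_sumr scalerBr addrACA -opprD opprB.
    by rewrite [RHS]addrC addrA subrK.
  apply: subspaceB; [by []| |by apply: coE; exact: sS.2].
  by apply: sI.2; exact: coE.
move=> a Sa; split=> [Ia|co0].
  apply: eI; rewrite -[X in I X](subKr a); apply: subspaceB => //.
  exact: coE.
have := coE a Sa; rewrite big1 ?subr0 // => i _.
by rewrite co0 scale0r.
Qed.

End FiniteGeneration.

(** * Separation by a linear functional *)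

(** A quadratic map [z |-> beta z z] with values in [W / J] whose sums vanish only for
trivial reasons is positive definite modulo [Z0] after composition with some
linear functional: in bases of [CZ / Z0] and [W / J] its components are matrices
to which [psd_alternative] applies. *)
Lemma separation (R : realType) (Z V : lmodType R) (beta : Z -> Z -> V)
    (CZ Z0 : set Z) (W J : set V) :
    (forall z, linear (beta z)) -> (forall z, linear (beta^~ z)) ->
    subspace CZ -> fin_gen CZ -> subspace Z0 ->
    subspace W -> fin_gen W -> subspace J ->
    (forall z z', CZ z -> CZ z' -> W (beta z z')) ->
    (forall z z0, CZ z -> CZ z0 -> Z0 z0 -> J (beta z z0 + beta z0 z)) ->
    (forall k (z : 'I_k -> Z), (forall i, CZ (z i)) ->
       J (\sum_i beta (z i) (z i)) -> forall i, Z0 (z i)) ->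
  exists lam : V -> R,
    [/\ forall c a b, W a -> W b -> lam (c *: a + b) = c * lam a + lam b,
        forall a, W a -> J a -> lam a = 0,
        forall z, CZ z -> 0 <= lam (beta z z)
      & forall z, CZ z -> ~ Z0 z -> 0 < lam (beta z z)].
Proof.
move=> linr linl sC fC sZ0 sW fW sJ WB cross noJ.
have [n [e [Ce eZ eC]]] := basis_mod sC fC sZ0.
have [m [co [coD coJ]]] := quotient_coord sW fW sJ.
pose betaL z : {linear Z -> V} := HB.pack (beta z)
  (GRing.isLinear.Build _ _ _ _ _ (linr z)).
pose betaR z : {linear Z -> V} := HB.pack (beta^~ z)
  (GRing.isLinear.Build _ _ _ _ _ (linl z)).
have bDr z a b : beta z (a + b) = beta z a + beta z b by exact: (raddfD (betaL z)).
have bDl z a b : beta (a + b) z = beta a z + beta b z by exact: (raddfD (betaR z)).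
have co_sum k (I : finType) (c : I -> R) (w : I -> V) : (forall i, W (w i)) ->
    co (\sum_i c i *: w i) k = \sum_i c i * co (w i) k.
  move=> Ww; elim: (index_enum I) => [|i r IH].
    by rewrite !big_nil; apply: (coJ 0 sW.1).1; exact: sJ.1.
  rewrite !big_cons coD ?IH //; apply: subspace_sum => // j _.
  exact: subspaceZ.
pose B k : 'M[R]_n := \matrix_(i, j) co (beta (e i) (e j)) k.
have coB k (u : 'rV[R]_n) (y := \sum_i u 0 i *: e i) :
    co (beta y y) k = (u *m B k *m u^T) 0 0.
  have -> : beta y y = \sum_i u 0 i *: \sum_j u 0 j *: beta (e i) (e j).
    rewrite -[LHS]/(betaR y y) linear_sum; apply: eq_bigr => i _.
    rewrite linearZ; congr (_ *: _).
    by rewrite -[LHS]/(betaL (e i) y) linear_sum; apply: eq_bigr => j _; rewrite linearZ.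
  rewrite co_sum => [|i]; last first.
    by apply: subspace_sum => // j _; apply: subspaceZ => //; exact: WB.
  rewrite -mulmxA mxE; apply: eq_bigr => i _; congr (_ * _).
  rewrite co_sum => [|j]; last exact: WB.
  by rewrite mxE; apply: eq_bigr => j _; rewrite !mxE mulrC.
have Cy (u : 'I_n -> R) : CZ (\sum_i u i *: e i).
  by apply: subspace_sum => // i _; exact: subspaceZ.
have [|c cpos] := @Compactness.psd_alternative R n m B.
  move=> A trA.
  pose y r := \sum_i A r i *: e i.
  have rowA r : \sum_i (row r A) 0 i *: e i = y r.
    by apply: eq_bigr => i _; rewrite mxE.
  have : J (\sum_r beta (y r) (y r)).
    have Wy r : W (beta (y r) (y r)) by apply: WB; exact: Cy.
    apply/coJ => [|k]; first by apply: subspace_sum => // r _.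
    have := co_sum k _ (fun=> 1) (fun r => beta (y r) (y r)) Wy.
    under eq_bigr do rewrite scale1r.
    move=> ->; rewrite -[RHS](trA k); apply: eq_bigr => r _.
    rewrite mul1r -rowA coB -!row_mul mxE.
    by rewrite mxE [in RHS]mxE; apply: eq_bigr => j _; rewrite !mxE.
  move=> /noJ yZ0; apply/matrixP => r i; rewrite mxE.
  by apply: (eZ (A r)); apply: yZ0 => r'; exact: Cy.
pose lam a := \sum_k c k * co a k.
have lamD : forall d a b, W a -> W b -> lam (d *: a + b) = d * lam a + lam b.
  move=> d a b Wa Wb; rewrite /lam mulr_sumr -big_split /=.
  by apply: eq_bigr => k _; rewrite coD // mulrDr mulrCA.
have lamJ a : W a -> J a -> lam a = 0.
  by move=> Wa Ja; rewrite /lam big1 // => k _; rewrite (coJ a Wa).1 ?mulr0.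
(* Replacing [z] by its representative in the span of [e] changes [beta z z] by an
   element of [J]; for the square of the difference this is [cross] halved. *)
have lamE z : CZ z -> exists2 u : 'rV[R]_n, Z0 (z - \sum_i u 0 i *: e i) &
    lam (beta z z) = \sum_k c k * (u *m B k *m u^T) 0 0.
  move=> Cz; have [u uZ0] := eC z Cz.
  pose u' := \row_i u i; have u'E : \sum_i u' 0 i *: e i = \sum_i u i *: e i.
    by apply: eq_bigr => i _; rewrite mxE.
  exists u'; first by rewrite u'E.
  pose y := \sum_i u' 0 i *: e i; pose z0 := z - y.
  have Cyy : CZ y by exact: Cy.
  have Cz0 : CZ z0 by exact: subspaceB.
  have Zz0 : Z0 z0 by rewrite /z0 /y u'E.
  have zE : z = y + z0 by rewrite addrC subrK.
  rewrite -(eq_bigr _ (fun k _ => congr1 (fun x => c k * x) (coB k u'))).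
  have J0 : J (beta z0 z0).
    have := subspaceZ 2^-1 sJ (cross _ _ Cz0 Cz0 Zz0).
    by rewrite -mulr2n -scaler_nat scalerA mulVf ?pnatr_eq0 // scale1r.
  pose d := beta y z0 + beta z0 y + beta z0 z0.
  have Wd : W d.
    apply: (subspaceD sW); last exact: WB.
    by apply: (subspaceD sW); exact: WB.
  have Jd : J d by apply: (subspaceD sJ) J0; exact: cross.
  have -> : beta z z = 1 *: d + beta y y.
    by rewrite zE bDl (bDr y y) (bDr z0 y) scale1r /d [RHS]addrC !addrA.
  by rewrite lamD ?(lamJ d) ?mulr0 ?add0r //; exact: WB.
exists lam; split=> // z Cz; have [u uZ0 ->] := lamE z Cz.
- have [->|u0] := eqVneq u 0; last exact: ltW (cpos _ u0).
  by rewrite big1 // => k _; rewrite !mul0mx mxE mulr0.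
- move=> nZ0; apply: cpos; apply/eqP => u0; apply: nZ0.
  by move: uZ0; rewrite u0 big1 ?subr0 // => i _; rewrite mxE scale0r.
Qed.

(** * Matrices over a real star algebra *)

(** The scalars act through a central ring morphism, as the constant polynomials do,
so that scaling a matrix is multiplication by a constant. *)
Record star_algebra (R : realType) (A : nzRingType) := StarAlgebra {
  scal :> {rmorphism R -> A};
  sinv : A -> A;
  scalC : forall c a, a * scal c = scal c * a;
  sinvD : forall a b, sinv (a + b) = sinv a + sinv b;
  sinvM : forall a b, sinv (a * b) = sinv b * sinv a;
  sinvK : involutive sinv;
  sinv_scal : forall c, sinv (scal c) = scal c }.

(** Matrices over [A] are a module over [A] only; this alias carries their structure
of a real vector space. *)
Definition rmod (R : realType) (A : nzRingType) (S : star_algebra R A) (m n : nat) : Type :=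
  'M[A]_(m, n).

Section RealModule.
Context {R : realType} {A : nzRingType} (S : star_algebra R A) {m n : nat}.

HB.instance Definition _ := GRing.Zmodule.on (rmod S m n).

Let rscale (c : R) (p : rmod S m n) : rmod S m n := scal S c *: (p : 'M[A]_(m, n)).

Let rscaleA a b v : rscale a (rscale b v) = rscale (a * b) v.
Proof. by rewrite /rscale scalerA -rmorphM. Qed.
Let rscale1 : left_id 1 rscale.
Proof. by move=> v; rewrite /rscale rmorph1 scale1r. Qed.
Let rscaleDr : right_distributive rscale +%R.
Proof. by move=> c u v; rewrite /rscale scalerDr. Qed.
Let rscaleDl v : {morph rscale^~ v : a b / a + b}.
Proof. by move=> a b; rewrite /rscale raddfD scalerDl. Qed.

HB.instance Definition _ := GRing.Zmodule_isLmodule.Build R (rmod S m n)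
  rscaleA rscale1 rscaleDr rscaleDl.

Lemma rscaleE (c : R) (p : rmod S m n) : c *: p = S c *: (p : 'M[A]_(m, n)).
Proof. by []. Qed.

End RealModule.

Section Adjoint.
Context {R : realType} {A : nzRingType} (S : star_algebra R A).

Definition gadj m n (p : 'M[A]_(m, n)) : 'M[A]_(n, m) := (map_mx (sinv S) p)^T.

Lemma sinv0 : sinv S 0 = 0.
Proof. by apply: (@addrI _ (sinv S 0)); rewrite -sinvD !addr0. Qed.

Lemma sinv_sum I (r : seq I) (P : pred I) (F : I -> A) :
  sinv S (\sum_(i <- r | P i) F i) = \sum_(i <- r | P i) sinv S (F i).
Proof. exact: (big_morph _ (@sinvD _ _ S) sinv0). Qed.

Lemma gadjE m n (p : 'M[A]_(m, n)) i j : gadj p i j = sinv S (p j i).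
Proof. by rewrite !mxE. Qed.

Lemma gadjD m n (p q : 'M[A]_(m, n)) : gadj (p + q) = gadj p + gadj q.
Proof. by apply/matrixP => i j; rewrite gadjE !mxE sinvD. Qed.

Lemma gadj0 m n : gadj (0 : 'M[A]_(m, n)) = 0.
Proof. by apply/matrixP => i j; rewrite gadjE !mxE sinv0. Qed.

Lemma gadj_sum m n I (r : seq I) (P : pred I) (F : I -> 'M[A]_(m, n)) :
  gadj (\sum_(i <- r | P i) F i) = \sum_(i <- r | P i) gadj (F i).
Proof. exact: (big_morph _ (@gadjD m n) (@gadj0 m n)). Qed.

Lemma gadjZ m n (c : R) (p : 'M[A]_(m, n)) : gadj (S c *: p) = S c *: gadj p.
Proof. by apply/matrixP => i j; rewrite gadjE !mxE sinvM sinv_scal scalC. Qed.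

Lemma gadjM m n k (p : 'M[A]_(m, n)) (q : 'M[A]_(n, k)) :
  gadj (p *m q) = gadj q *m gadj p.
Proof.
apply/matrixP => i j; rewrite gadjE !mxE sinv_sum; apply: eq_bigr => s _.
by rewrite !gadjE sinvM.
Qed.

Lemma gadjK m n (p : 'M[A]_(m, n)) : gadj (gadj p) = p.
Proof. by apply/matrixP => i j; rewrite !gadjE sinvK. Qed.

Lemma gadj_linear m n : linear (@gadj m n : rmod S m n -> rmod S n m).
Proof. by move=> c q r; rewrite [gadj _]gadjD; congr (_ + _); exact: gadjZ. Qed.

Lemma gadj_scalar (a : A) : gadj (a%:M : 'M_1) = (sinv S a)%:M.
Proof. by apply/matrixP => i j; rewrite gadjE !ord1 !mxE eqxx. Qed.

Lemma rscalemxAr m n k (c : R) (p : 'M[A]_(m, n)) (q : 'M[A]_(n, k)) :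
  p *m (S c *: q) = S c *: (p *m q).
Proof.
apply/matrixP => i j; rewrite !mxE mulr_sumr; apply: eq_bigr => s _.
by rewrite mxE mulrA scalC mulrA.
Qed.

Lemma mulmx_linearr m n k (p : 'M[A]_(m, n)) :
  linear ((fun q => p *m q) : rmod S n k -> rmod S m k).
Proof. by move=> c q r; rewrite [p *m _]mulmxDr; congr (_ + _); exact: rscalemxAr. Qed.

Lemma mulmx_linearl m n k (p : 'M[A]_(n, k)) :
  linear ((fun q => q *m p) : rmod S m n -> rmod S m k).
Proof. by move=> c q r; rewrite [_ *m p]mulmxDl; congr (_ + _); rewrite -scalemxAl. Qed.

Lemma mulmx_col_row m k n (p : 'M[A]_(m, k)) (q : 'M[A]_(k, n)) :
  p *m q = \sum_s col s p *m row s q.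
Proof.
apply/matrixP => i j; rewrite mxE summxE; apply: eq_bigr => s _.
by rewrite mxE big_ord1 !mxE.
Qed.

Lemma col_gadj m n (p : 'M[A]_(m, n)) s : col s (gadj p) = gadj (row s p).
Proof. by apply/matrixP => i j; rewrite !mxE. Qed.

End Adjoint.

Section EvalMatrix.
Context {R : realType} {A : nzRingType} (S : star_algebra R A) {n : nat}.

Record star_rep (phi : A -> 'M[R]_n) : Prop := StarRep {
  repD : forall a b, phi (a + b) = phi a + phi b;
  repM : forall a b, phi (a * b) = phi a *m phi b;
  rep_inv : forall a, phi (sinv S a) = (phi a)^T;
  rep_scal : forall c, phi (S c) = c%:M }.

Context (phi : A -> 'M[R]_n) (rphi : star_rep phi).

Definition geval m k (p : 'M[A]_(m, k)) : 'M[R]_(m * n, k * n) :=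
  \matrix_(u, v) phi (p (mxtens_unindex u).1 (mxtens_unindex v).1)
    (mxtens_unindex u).2 (mxtens_unindex v).2.

Lemma gevalE m k (p : 'M[A]_(m, k)) i j s t :
  geval p (mxtens_index (i, s)) (mxtens_index (j, t)) = phi (p i j) s t.
Proof. by rewrite mxE !mxtens_indexK. Qed.

Lemma gevalP m k (p : 'M[A]_(m, k)) (B : 'M[R]_(m * n, k * n)) :
  (forall i j s t, B (mxtens_index (i, s)) (mxtens_index (j, t)) = phi (p i j) s t)
  <-> geval p = B.
Proof.
split=> [BE|<- i j s t]; last exact: gevalE.
apply/matrixP => u v.
case: (mxtens_indexP u) => i s; case: (mxtens_indexP v) => j t.
by rewrite gevalE BE.
Qed.

Lemma rep0 : phi 0 = 0.
Proof. by apply: (@addrI _ (phi 0)); rewrite -(repD rphi) !addr0. Qed.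

Lemma rep_sum I (r : seq I) (P : pred I) (F : I -> A) :
  phi (\sum_(i <- r | P i) F i) = \sum_(i <- r | P i) phi (F i).
Proof. exact: (big_morph _ (repD rphi) rep0). Qed.

Lemma gevalD m k (p q : 'M[A]_(m, k)) : geval (p + q) = geval p + geval q.
Proof. by apply/gevalP => i j s t; rewrite mxE !gevalE mxE (repD rphi) mxE. Qed.

Lemma geval0 m k : geval (0 : 'M[A]_(m, k)) = 0.
Proof. by apply/gevalP => i j s t; rewrite !mxE rep0 mxE. Qed.

Lemma geval_sum m k I (r : seq I) (P : pred I) (F : I -> 'M[A]_(m, k)) :
  geval (\sum_(i <- r | P i) F i) = \sum_(i <- r | P i) geval (F i).
Proof. exact: (big_morph _ (@gevalD m k) (@geval0 m k)). Qed.

Lemma geval_adj m k (p : 'M[A]_(m, k)) : geval (gadj S p) = (geval p)^T.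
Proof. by apply/gevalP => i j s t; rewrite mxE gevalE gadjE (rep_inv rphi) mxE. Qed.

Lemma gevalM m k l (p : 'M[A]_(m, k)) (q : 'M[A]_(k, l)) :
  geval (p *m q) = geval p *m geval q.
Proof.
apply/gevalP => i j s t; rewrite !mxE rep_sum summxE.
rewrite (reindex (@mxtens_index k n)) /=; last first.
  by exists (@mxtens_unindex k n) => v _; rewrite (mxtens_indexK, mxtens_unindexK).
transitivity (\sum_(v : 'I_k * 'I_n) phi (p i v.1) s v.2 * phi (q v.1 j) v.2 t).
  by apply: eq_bigr => -[u v] _; rewrite !gevalE.
rewrite -(pair_bigA _ (fun u v => phi (p i u) s v * phi (q u j) v t)) /=.
by apply: eq_bigr => u _; rewrite (repM rphi) mxE.
Qed.

Lemma gevalZ0 m k f (p : 'M[A]_(m, k)) : geval p = 0 -> geval (f *: p) = 0.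
Proof. by move=> p0; rewrite -mul_scalar_mx gevalM p0 mulmx0. Qed.

Lemma geval_rows m k (p : 'M[A]_(m, k)) :
  (forall i, geval (row i p) = 0) <-> geval p = 0.
Proof.
split=> [p0|p0 i]; last by rewrite rowE gevalM p0 mulmx0.
apply/gevalP => i j s t; rewrite mxE.
have := congr1 (fun B : 'M_(_, _) => B (mxtens_index (0, s)) (mxtens_index (j, t))) (p0 i).
by rewrite gevalE !mxE.
Qed.

End EvalMatrix.

Section RowSpaces.
Context {R : realType} {A : nzRingType} (S : star_algebra R A).

Definition rows_of nu l (C : set (rmod S 1 l)) : set (rmod S nu l) :=
  [set q | forall s, C (row s q)].

Arguments rows_of nu {l} C.

Lemma rows_of_fin_gen nu l (C : set (rmod S 1 l)) :
  fin_gen C -> fin_gen (rows_of nu C).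
Proof.
move=> /fin_gen_span_ord[k [b Cb]].
pose d (i : 'I_nu * 'I_k) : rmod S nu l := delta_mx i.1 0 *m b i.2.
apply: (@fin_gen_span _ _ _ d) => q Cq.
have sS := span_subspace d.
have -> : q = \sum_s delta_mx s 0 *m row s q.
  apply/matrixP => i j; rewrite summxE (bigD1 i) //= mxE big_ord1 !mxE !eqxx mul1r.
  rewrite big1 ?addr0 // => s /negPf si.
  by rewrite mxE big_ord1 !mxE eq_sym si mul0r.
apply: (subspace_sum sS) => s _.
pose T : set (rmod S 1 l) := (fun q' => delta_mx s 0 *m q' : rmod S nu l) @^-1` span d.
have sub : subspace T.
  exact: (preim_subspace (@mulmx_linearr _ _ S _ _ l (delta_mx s 0)) sS).
suff : T (row s q) by [].
have [c ->] := Cb _ (Cq s).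
apply: (subspace_sum sub) => i _; apply: (subspaceZ _ sub).
exact: (mem_span d (s, i)).
Qed.

Lemma rows_of_subspace nu l (C : set (rmod S 1 l)) :
  subspace C -> subspace (rows_of nu C).
Proof.
move=> [C0 CD]; split=> [s|c u v Cu Cv s]; first by rewrite raddf0.
rewrite (_ : row s _ = S c *: row s u + row s v); first exact: CD.
by apply/matrixP => i j; rewrite !mxE.
Qed.

End RowSpaces.
Arguments rows_of {R A S} nu {l} C.

(** * The separating functional *)

(** The linearity of each of the three terms of the quadratic map in
[separating_functional], put together. *)
Lemma lin_comb3 (R : realType) (V : lmodType R) (c x y : R) (a a' b b' p : V) :
  (c *: a + a') + (c *: b + b') - (c * x + y) *: p
  = c *: (a + b - x *: p) + (a' + b' - y *: p).
Proof.
by rewrite scalerDl -scalerA opprD (addrACA (c *: a)) (addrACA (c *: a + _)) scalerBr scalerDr.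
Qed.

Section Separation.
Context {R : realType} {A : nzRingType} (S : star_algebra R A) {l nu : nat}.
Context (C I : set (rmod S 1 l)) (D : set (rmod S 1 1)) (L : 'M[A]_nu).

(** [D] consists of 1 x 1 matrices, so that its products with rows are matrix
products. *)
Definition span_DC : set (rmod S 1 l) :=
  lspan [set (d *m b : rmod S 1 l) | d in D & b in C].

Definition span_CDC : set (rmod S l l) :=
  lspan [set (gadj S a *m f : rmod S l l) | a in C & f in span_DC].

(** The symmetric elements on which a functional that is compatible with [I] has to
vanish. *)
Definition null_forms : set (rmod S l l) :=
  lspan [set (gadj S r *m i + gadj S i *m r : rmod S l l) | r in C & i in I `&` span_DC].

Hypotheses (sC : subspace C) (fC : fin_gen C) (fD : fin_gen D) (D1 : D 1%:M).
Hypotheses (D_adj : forall d, D d -> D (gadj S d)).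
Hypotheses (DL : forall s t, D (L s t)%:M) (symL : gadj S L = L).
Hypotheses (sI : subspace I).

Lemma span_DC_subspace : subspace span_DC. Proof. exact: lspan_subspace. Qed.
Lemma span_CDC_subspace : subspace span_CDC. Proof. exact: lspan_subspace. Qed.
Lemma null_forms_subspace : subspace null_forms. Proof. exact: lspan_subspace. Qed.

Lemma mem_span_DC d b : D d -> C b -> span_DC (d *m b).
Proof. by move=> Dd Cb; apply: sub_lspan; exists d => //; exists b. Qed.

Lemma sub_span_DC : C `<=` span_DC.
Proof. by move=> b Cb; have := mem_span_DC D1 Cb; rewrite mul1mx. Qed.

Lemma mem_span_CDC a f : C a -> span_DC f -> span_CDC (gadj S a *m f).
Proof. by move=> Ca Mf; apply: sub_lspan; exists a => //; exists f. Qed.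

Lemma span_CDC_adj f : span_CDC f -> span_CDC (gadj S f).
Proof.
apply: (lspan_min (preim_subspace (@gadj_linear _ _ S l l) span_CDC_subspace)).
move=> _ [a Ca [h Mh <-]]; rewrite /preimage /= gadjM gadjK; move: h Mh.
have lin : linear (fun h : rmod S 1 l => gadj S h *m a : rmod S l l).
  move=> c u v; rewrite [gadj S _]gadj_linear.
  exact: (@mulmx_linearl _ _ S l 1 l a).
apply: (lspan_min (preim_subspace lin span_CDC_subspace)).
move=> _ [d Dd [b Cb <-]]; rewrite /preimage /= gadjM -mulmxA.
by apply: mem_span_CDC => //; apply: mem_span_DC => //; exact: D_adj.
Qed.

Lemma span_CDC_fin_gen : fin_gen span_CDC.
Proof.
have f1 : fin_gen span_DC.
  apply: fin_gen_lspan.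
  apply: (fin_gen_bilin (f := fun (d : rmod S 1 1) (b : rmod S 1 l) => d *m b : rmod S 1 l)
    _ _ fD fC) => //.
    by move=> v; exact: mulmx_linearr.
  by move=> v; exact: mulmx_linearl.
apply: fin_gen_lspan.
have fa : fin_gen ((@gadj _ _ S 1 l : rmod S 1 l -> rmod S l 1) @` C).
  by apply: fin_gen_image => //; exact: gadj_linear.
apply: (fin_gen_bilin (f := fun (a : rmod S l 1) (f : rmod S 1 l) => a *m f : rmod S l l)
  _ _ fa f1) => //.
- by move=> v; exact: mulmx_linearr.
- by move=> v; exact: mulmx_linearl.
- by move=> _ [a Ca [f Mf <-]]; exists (gadj S a); [exists a | exists f].
Qed.

Lemma row_pencil_span_DC q s : rows_of nu C q -> span_DC (row s (L *m q)).
Proof.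
move=> Cq; rewrite (_ : row s _ = \sum_t (L s t)%:M *m row t q).
  by apply: (subspace_sum span_DC_subspace) => t _; exact: mem_span_DC.
apply/matrixP => i j; rewrite !mxE summxE; apply: eq_bigr => t _.
by rewrite mul_scalar_mx !mxE.
Qed.

(** [separation] for the form polarising [(a, q, t) |-> a^* a + q^* L q - t^2 p].  If
values of this map add up to a null form and some [t] is nonzero, division by the sum
of the [t^2] gives the excluded certificate of [p]; otherwise the reality of [I]
applies.  Averaging over the involution makes the functional symmetric. *)
Theorem separating_functional (p : 'M[A]_l) :
    (forall np nq (ps : 'I_np -> rmod S 1 l) (qs : 'I_nq -> rmod S nu l),
       (forall i, C (ps i)) -> (forall j, rows_of nu C (qs j)) ->
       null_forms (\sum_i gadj S (ps i) *m ps i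
                   + \sum_j gadj S (qs j) *m L *m qs j) ->
       (forall i, I (ps i)) /\ forall j, rows_of nu I (L *m qs j)) ->
    span_CDC p -> gadj S p = p ->
    (forall np nq (ps : 'I_np -> rmod S 1 l) (qs : 'I_nq -> rmod S nu l),
       (forall i, C (ps i)) -> (forall j, rows_of nu C (qs j)) ->
       ~ null_forms (p - (\sum_i gadj S (ps i) *m ps i
                          + \sum_j gadj S (qs j) *m L *m qs j))) ->
  exists lam : rmod S l l -> R,
    [/\ forall c a b, span_CDC a -> span_CDC b -> lam (c *: a + b) = c * lam a + lam b,
        forall a, span_CDC a -> lam (gadj S a) = lam a,
        forall a i, C a -> I i -> span_DC i -> lam (gadj S a *m i) = 0,
        forall a, C a -> ~ I a -> 0 < lam (gadj S a *m a)
      & (forall q, rows_of nu C q -> 0 <= lam (gadj S q *m L *m q)) /\ lam p < 0].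
Proof.
move=> realI Wp symp nocert.
pose Z : lmodType R := (rmod S 1 l * rmod S nu l * R^o)%type.
pose beta (z z' : Z) : rmod S l l :=
  (gadj S z.1.1 *m z'.1.1 + gadj S z.1.2 *m L *m z'.1.2 : rmod S l l)
  - ((z.2 * z'.2 : R) *: (p : rmod S l l)).
pose CZ : set Z := (C `*` rows_of nu C) `*` setT.
pose Z0 : set Z := [set z | [/\ I z.1.1, rows_of nu I (L *m z.1.2) & z.2 = 0]].
have W2 a b : C a -> C b -> span_CDC (gadj S a *m b).
  by move=> Ca /sub_span_DC; exact: mem_span_CDC.
have WL a b : rows_of nu C a -> rows_of nu C b -> span_CDC (gadj S a *m L *m b).
  move=> Ca Cb; rewrite -mulmxA mulmx_col_row.
  apply: (subspace_sum span_CDC_subspace) => s _; rewrite col_gadj.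
  by apply: mem_span_CDC; [exact: Ca | exact: row_pencil_span_DC].
have sW := span_CDC_subspace.
have betar z : linear (beta z).
  move=> c u v; rewrite /beta -lin_comb3.
  congr (_ + _ - _ *: _); last first.
    have -> : (c *: u + v).2 = c * u.2 + v.2 :> R by [].
    by rewrite mulrDr mulrCA.
  - exact: (@mulmx_linearr _ _ S _ _ l (gadj S z.1.2 *m L) c u.1.2 v.1.2).
  - exact: (@mulmx_linearr _ _ S _ _ l (gadj S z.1.1) c u.1.1 v.1.1).
have betal z : linear (beta^~ z).
  move=> c u v; rewrite /beta -lin_comb3.
  congr (_ + _ - _ *: _); last first.
    have -> : (c *: u + v).2 = c * u.2 + v.2 :> R by [].
    by rewrite mulrDl mulrA.
  - rewrite -!mulmxA.
    rewrite -[RHS](@mulmx_linearl _ _ S _ _ l (L *m z.1.2) c (gadj S u.1.2) (gadj S v.1.2)).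
    by congr (_ *m _); exact: (@gadj_linear _ _ S nu l c u.1.2 v.1.2).
  - rewrite -[RHS](@mulmx_linearl _ _ S _ _ l z.1.1 c (gadj S u.1.1) (gadj S v.1.1)).
    by congr (_ *m _); exact: (@gadj_linear _ _ S 1 l c u.1.1 v.1.1).
have sCZ : subspace CZ.
  apply: subspaceX; first by apply: subspaceX => //; exact: rows_of_subspace.
  by split.
have fCZ : fin_gen CZ.
  apply: fin_genX; first by apply: fin_genX => //; exact: rows_of_fin_gen.
  exists 1%N, (fun=> 1) => t _; exists (fun=> t).
  by rewrite big_ord1 /GRing.scale /= mulr1.
have sZ0 : subspace Z0.
  split=> [|c u v [Iu Lu u0] [Iv Lv v0]]; split=> /=.
  - by case: sI.
  - by move=> s; rewrite mulmx0 raddf0; case: sI.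
  - by [].
  - exact: sI.2.
  - have := (rows_of_subspace nu sI).2 c _ _ Lu Lv; congr (rows_of nu I _).
    by rewrite [RHS](@mulmx_linearr _ _ S _ _ l L c u.1.2 v.1.2).
  - by rewrite u0 v0 scaler0 addr0.
have WB z z' : CZ z -> CZ z' -> span_CDC (beta z z').
  move=> [[Cz1 Cz2] _] [[Cz1' Cz2'] _]; apply: (subspaceB sW).
    by apply: (subspaceD sW); [exact: W2 | exact: WL].
  exact: (subspaceZ _ sW).
have cross z z0 : CZ z -> CZ z0 -> Z0 z0 -> null_forms (beta z z0 + beta z0 z).
  move=> [[Cz1 Cz2] _] [[Cz1' Cz2'] _] [Iz0 LZ0 z00].
  have -> : beta z z0 + beta z0 z = (gadj S z.1.1 *m z0.1.1 + gadj S z0.1.1 *m z.1.1)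
     + \sum_s (gadj S (row s z.1.2) *m row s (L *m z0.1.2)
               + gadj S (row s (L *m z0.1.2)) *m row s z.1.2).
    rewrite /beta z00 mulr0 mul0r scale0r !subr0 addrACA; congr (_ + _).
    rewrite big_split /= -mulmxA mulmx_col_row; congr (_ + _).
      by apply: eq_bigr => s _; rewrite col_gadj.
    rewrite -{1}symL -gadjM mulmx_col_row.
    by apply: eq_bigr => s _; rewrite col_gadj.
  apply: (subspaceD null_forms_subspace).
    apply: sub_lspan; exists z.1.1 => //; exists z0.1.1 => //.
    by split=> //; exact: sub_span_DC.
  apply: (subspace_sum null_forms_subspace) => s _.
  apply: sub_lspan; exists (row s z.1.2); first exact: Cz2.
  exists (row s (L *m z0.1.2)) => //; split; first exact: LZ0.
  exact: row_pencil_span_DC.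
have noJ k (z : 'I_k -> Z) : (forall i, CZ (z i)) ->
    null_forms (\sum_i beta (z i) (z i)) -> forall i, Z0 (z i).
  move=> Cz; pose t := \sum_i (z i).2 * (z i).2 : R.
  have -> : \sum_i beta (z i) (z i)
     = (\sum_i gadj S (z i).1.1 *m (z i).1.1
        + \sum_i gadj S (z i).1.2 *m L *m (z i).1.2 : rmod S l l) - t *: (p : rmod S l l).
    by rewrite /beta sumrB big_split /= scaler_suml.
  have C1 i : C (z i).1.1 by case: (Cz i) => -[].
  have C2 i : rows_of nu C (z i).1.2 by case: (Cz i) => -[].
  have [t0|t_neq0] := eqVneq t 0.
    rewrite t0 scale0r subr0 => /(realI _ _ _ _ C1 C2)[I1 I2] i; split=> //.
    move/eqP: t0; rewrite psumr_eq0 => [/allP/(_ i)|j _]; last by rewrite -expr2 sqr_ge0.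
    by rewrite mem_index_enum mulf_eq0 orbb => /(_ isT)/eqP.
  move=> Jt; exfalso.
  have t_gt0 : 0 < t.
    by rewrite lt0r t_neq0 sumr_ge0 // => i _; rewrite -expr2 sqr_ge0.
  (* Rescaling by [c] divides the squares by [t]. *)
  pose c := Num.sqrt t^-1; have cc : c * c = t^-1.
    by rewrite -expr2 sqr_sqrtr // invr_ge0 ltW.
  have conjZ m (M : 'M[A]_m) (q : rmod S m l) :
      gadj S (c *: q) *m M *m (c *: q) = t^-1 *: (gadj S q *m M *m q : rmod S l l).
    rewrite [gadj S _]gadjZ -!scalemxAl [_ *m (c *: q)]rscalemxAr -cc.
    by rewrite rscaleE scalerA -rmorphM.
  pose ps i : rmod S 1 l := c *: (z i).1.1.
  pose qs i : rmod S nu l := c *: (z i).1.2.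
  apply: (nocert k k ps qs).
  - by move=> i; exact: (subspaceZ c sC (C1 i)).
  - by move=> i; exact: (subspaceZ c (rows_of_subspace nu sC) (C2 i)).
  have -> : \sum_i gadj S (ps i) *m ps i + \sum_i gadj S (qs i) *m L *m qs i
     = t^-1 *: (\sum_i gadj S (z i).1.1 *m (z i).1.1
        + \sum_i gadj S (z i).1.2 *m L *m (z i).1.2 : rmod S l l).
    rewrite scalerDr !scaler_sumr; congr (_ + _); apply: eq_bigr => i _.
      by have := conjZ 1%N 1%:M (z i).1.1; rewrite !mulmx1.
    exact: conjZ.
  have := subspaceZ (- t^-1) null_forms_subspace Jt.
  by rewrite scaleNr scalerBr opprB scalerA mulVf // scale1r.
have [lam [lamD lamJ lam_ge0 lam_gt0]] :=
  separation betar betal sCZ fCZ sZ0 sW span_CDC_fin_gen null_forms_subspace WB cross noJ.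
have lam0 : lam 0 = 0 by apply: lamJ; [exact: sW.1 | exact: null_forms_subspace.1].
have lamDD a b : span_CDC a -> span_CDC b -> lam (a + b) = lam a + lam b.
  by move=> Wa Wb; rewrite -[a in LHS]scale1r lamD // mul1r.
have lamZ c a : span_CDC a -> lam (c *: a) = c * lam a.
  by move=> Wa; rewrite -[_ *: _]addr0 lamD ?lam0 ?addr0 //; exact: sW.1.
pose mu a := 2^-1 * (lam a + lam (gadj S a)).
have muE a : gadj S a = a -> mu a = lam a.
  by move=> aa; rewrite /mu aa; field.
have in0 : rows_of nu C 0 by move=> s; rewrite raddf0; case: sC.
exists mu; split.
- move=> c a b Wa Wb; rewrite /mu lamD //.
  rewrite (_ : gadj S _ = c *: (gadj S a : rmod S l l) + gadj S b); last exact: gadj_linear.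
  by rewrite lamD; try exact: span_CDC_adj; ring.
- by move=> a Wa; rewrite /mu gadjK addrC.
- move=> a i Ca Ii Mi; have Wai : span_CDC (gadj S a *m i) by exact: mem_span_CDC.
  rewrite /mu -lamDD //; last exact: span_CDC_adj.
  rewrite gadjM gadjK lamJ ?mulr0 //.
    apply: (subspaceD sW) => //.
    by have := span_CDC_adj Wai; rewrite gadjM gadjK.
  by apply: sub_lspan; exists a => //; exists i.
- move=> a Ca nIa; rewrite muE; last by rewrite gadjM gadjK.
  have := @lam_gt0 ((a, 0), 0); rewrite /beta /= mulmx0 addr0 mulr0 scale0r subr0.
  by apply; [split=> //; split | case].
- split=> [q Cq|]; rewrite muE //.
    have := @lam_ge0 ((0, q), 0); rewrite /beta /= mulmx0 add0r mulr0 scale0r subr0.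
    by apply; split=> //; split=> //; case: sC.
    by rewrite !gadjM gadjK symL mulmxA.
  have := @lam_gt0 ((0, 0), 1); rewrite /beta /= !mulmx0 addr0 mulr1 scale1r sub0r.
  rewrite -scaleN1r lamZ // mulN1r oppr_gt0; apply; first by split=> //; split=> //; case: sC.
  by case=> _ _ /= /eqP; rewrite oner_eq0.
Qed.

End Separation.

(** * The Gelfand-Naimark-Segal construction *)

Section Orthonormal.
Context {R : realType} {V : lmodType R} (C I : set V) (B : V -> V -> R).
Hypotheses (sC : subspace C) (fC : fin_gen C) (sI : subspace I).
Hypotheses (symB : forall a b, C a -> C b -> B a b = B b a).
Hypotheses (linB : forall c a b d, C a -> C b -> C d ->
  B a (c *: b + d) = c * B a b + B a d).
Hypotheses (nullB : forall a i, C a -> C i -> I i -> B a i = 0).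
Hypotheses (posB : forall a, C a -> ~ I a -> 0 < B a a).

Let B_sum (T : finType) a (c : T -> R) (b : T -> V) : C a -> (forall i, C (b i)) ->
  B a (\sum_i c i *: b i) = \sum_i c i * B a (b i).
Proof.
move=> Ca Cb; elim: (index_enum T) => [|i r IHr].
  by rewrite !big_nil nullB //; [case: sC | case: sI].
rewrite !big_cons linB ?IHr //.
by apply: (subspace_sum sC) => j _; exact: subspaceZ.
Qed.

(** A basis modulo [I] has a positive definite Gram matrix [Q^T Q]; the change of
basis by the inverse of [Q] makes it orthonormal. *)
Lemma orthonormal_basis : exists (n : nat) (e : 'I_n -> V),
  [/\ forall i, C (e i), forall i j, B (e i) (e j) = (i == j)%:R
    & forall a, C a -> I (a - \sum_i B (e i) a *: e i)].
Proof.
have [n [f [Cf fI fC']]] := basis_mod sC fC sI.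
have Csum (c : 'I_n -> R) : C (\sum_i c i *: f i).
  by apply: (subspace_sum sC) => i _; exact: subspaceZ.
pose G : 'M[R]_n := \matrix_(i, j) B (f i) (f j).
have GB (u v : 'I_n -> R) : B (\sum_i u i *: f i) (\sum_j v j *: f j)
    = ((\row_i u i) *m G *m (\col_j v j)) 0 0.
  rewrite B_sum //; rewrite mxE; apply: eq_bigr => j _.
  rewrite symB // B_sum // mulrC; congr (_ * _); last by rewrite mxE.
  by rewrite mxE; apply: eq_bigr => i _; rewrite !mxE symB.
have rowcol (u : 'cV[R]_n) : \row_i u i 0 = u^T /\ \col_i u i 0 = u.
  by split; [apply/rowP => i | apply/colP => i]; rewrite !mxE.
have psdG : psdmx G.
  split; first by apply/matrixP => i j; rewrite !mxE symB.
  move=> u; have := GB (fun i => u i 0) (fun i => u i 0).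
  have [-> ->] := rowcol u => <-.
  set y := \sum_i _; have [Iy|nIy] := pselect (I y); last exact: ltW (posB (Csum _) nIy).
  by rewrite (nullB (Csum _) (Csum _) Iy).
have [Q GQ] := psd_sqrt psdG.
have Qu : Q \in unitmx.
  rewrite -unitmx_tr -row_free_unit -kermx_eq0; apply: contraT => /rowV0Pn[c].
  move=> /sub_kermxP cQ c0; have := GB (fun i => c 0 i) (fun i => c 0 i).
  have [-> ->] : \row_i c 0 i = c /\ \col_i c 0 i = c^T.
    by split; [apply/rowP => i | apply/colP => i]; rewrite !mxE.
  rewrite GQ mulmxA cQ !mul0mx mxE; set y := \sum_i _ => Byy.
  have [/fI ci0|/(posB (Csum _))] := pselect (I y); last by rewrite Byy ltxx.
  by case/eqP: c0; apply/rowP => i; rewrite mxE.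
have PQ : invmx Q *m Q = 1%:M by exact: mulVmx.
have QP : Q *m invmx Q = 1%:M by exact: mulmxV.
pose P := invmx Q; pose e j := \sum_i P i j *: f i.
have Ce j : C (e j) by exact: Csum.
have PG : P^T *m G = Q by rewrite GQ mulmxA -trmx_mul QP trmx1 mul1mx.
have Be j (c : 'I_n -> R) : B (e j) (\sum_i c i *: f i) = (Q *m \col_i c i) j 0.
  rewrite GB -[in RHS]PG (_ : \row_k P k j = row j P^T).
    by rewrite -!row_mul mxE.
  by apply/rowP => k; rewrite !mxE.
exists n, e; split=> // [i j|a Ca].
  rewrite Be (_ : \col_k P k j = col j P); last by apply/matrixP => k k'; rewrite !mxE.
  by rewrite colE mulmxA QP mul1mx !mxE eqxx andbT.
have [c ac] := fC' a Ca.
have -> : \sum_i B (e i) a *: e i = \sum_i c i *: f i => //.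
pose y := \sum_i c i *: f i; have Cy : C y by exact: Csum.
have Ba i : B (e i) a = (Q *m \col_k c k) i 0.
  rewrite -Be -/y -[a in LHS](subrK y) -[a - y]scale1r linB //; last exact: subspaceB.
  by rewrite nullB ?mulr0 ?add0r //; exact: subspaceB.
under eq_bigr do rewrite Ba scaler_sumr.
rewrite exchange_big; apply: eq_bigr => i _ /=.
under eq_bigr do rewrite scalerA.
rewrite -scaler_suml; congr (_ *: _).
transitivity ((P *m (Q *m \col_k c k)) i 0); last by rewrite mulmxA PQ mul1mx mxE.
by rewrite mxE; apply: eq_bigr => j _; rewrite mulrC.
Qed.

End Orthonormal.

Section GNS.
Context {R : realType} {A : nzRingType} (S : star_algebra R A) {l nu : nat}.
Context (C I : set (rmod S 1 l)) (D : set (rmod S 1 1)) (L : 'M[A]_nu).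
Context (lam : rmod S l l -> R).

Hypotheses (sC : subspace C) (fC : fin_gen C) (D1 : D 1%:M).
Hypotheses (D_adj : forall d, D d -> D (gadj S d)).
Hypotheses (DL : forall s t, D (L s t)%:M) (symL : gadj S L = L).
Hypotheses (sI : subspace I) (modI : forall (d : 'M[A]_1) u, I u -> I (d *m u)).

Let W := span_CDC C D.
Hypotheses (lamP : forall c a b, W a -> W b -> lam (c *: a + b) = c * lam a + lam b).
Hypotheses (lam_adj : forall a, W a -> lam (gadj S a) = lam a).
Hypotheses (lamI : forall a i, C a -> I i -> span_DC C D i -> lam (gadj S a *m i) = 0).
Hypotheses (lam_gt0 : forall a, C a -> ~ I a -> 0 < lam (gadj S a *m a)).
Hypotheses (lam_pencil : forall q, rows_of nu C q -> 0 <= lam (gadj S q *m L *m q)).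

Let sW : subspace W. Proof. exact: span_CDC_subspace. Qed.
Let W2 a f : C a -> span_DC C D f -> W (gadj S a *m f). Proof. exact: mem_span_CDC. Qed.

Lemma lam_sum (T : finType) (c : T -> R) (w : T -> rmod S l l) :
  (forall i, W (w i)) -> lam (\sum_i c i *: w i) = \sum_i c i * lam (w i).
Proof.
move=> Ww; have lam0 : lam 0 = 0.
  by have := lamP (-1) sW.1 sW.1; rewrite scaler0 addr0 mulN1r addNr.
elim: (index_enum T) => [|i r IHr]; first by rewrite !big_nil.
rewrite !big_cons lamP ?IHr //.
by apply: (subspace_sum sW) => j _; exact: subspaceZ.
Qed.

(** By symmetry this is [lam (b^* (d^* a))], and [d^* a] is in [I] as well. *)
Lemma lam_null_left a d b : C a -> I a -> D d -> C b -> lam (gadj S a *m (d *m b)) = 0.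
Proof.
move=> Ca Ia Dd Cb; rewrite -lam_adj; last by apply: W2 => //; exact: mem_span_DC.
rewrite gadjM gadjK gadjM -mulmxA lamI //; first exact: modI.
by apply: mem_span_DC => //; exact: D_adj.
Qed.

Lemma gns_basis : exists (n : nat) (e : 'I_n -> rmod S 1 l),
  [/\ forall i, C (e i), forall i j, lam (gadj S (e i) *m e j) = (i == j)%:R
    & forall a, C a -> I (a - \sum_i lam (gadj S (e i) *m a) *: e i)].
Proof.
pose B (a b : rmod S 1 l) := lam (gadj S a *m b).
have M1 a : C a -> span_DC C D a by exact: sub_span_DC.
apply: (@orthonormal_basis _ _ C I B) => //.
- by move=> a b Ca Cb; rewrite /B -lam_adj ?gadjM ?gadjK //; apply: W2 => //; exact: M1.
- move=> c a b d Ca Cb Cd; rewrite /B -lamP; [|by apply: W2 => //; exact: M1..].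
  by congr (lam _); exact: (@mulmx_linearr _ _ S _ _ l (gadj S a) c b d).
- by move=> a i Ca Ci Ii; apply: lamI => //; exact: M1.
Qed.

Context (n : nat) (e : 'I_n -> rmod S 1 l).
Hypotheses (Ce : forall i, C (e i)).
Hypotheses (orthE : forall i j, lam (gadj S (e i) *m e j) = (i == j)%:R).
Hypotheses (basisE : forall a, C a -> I (a - \sum_i lam (gadj S (e i) *m a) *: e i)).

(** The coordinates of the class of [f] in [C / (C /\ I)] with respect to [e].  The
formula also makes sense on [D C], where it describes the compressed products
([gns_op_vec]). *)
Definition gns_vec (f : rmod S 1 l) : 'cV[R]_n := \col_i lam (gadj S (e i) *m f).

(** Multiplication by [d] leads out of [C]; this is its compression to
[C / (C /\ I)]. *)
Definition gns_op (d : rmod S 1 1) : 'M[R]_n :=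
  \matrix_(i, j) lam (gadj S (e i) *m (d *m e j)).

Let M1 d b : D d -> C b -> span_DC C D (d *m b). Proof. exact: mem_span_DC. Qed.

Lemma gns_opP c d d' : D d -> D d' -> gns_op (c *: d + d') = c *: gns_op d + gns_op d'.
Proof.
move=> Dd Dd'; apply/matrixP => i j; rewrite !mxE.
rewrite -lamP; [|by apply: W2 => //; exact: M1..]; congr (lam _).
rewrite -[RHS](@mulmx_linearr _ _ S _ _ l (gadj S (e i)) c (d *m e j) (d' *m e j)).
by congr (_ *m _); exact: (@mulmx_linearl _ _ S _ _ l (e j) c d d').
Qed.

Lemma gns_op1 : gns_op 1%:M = 1%:M.
Proof. by apply/matrixP => i j; rewrite !mxE mul1mx orthE. Qed.

Lemma gns_op_adj d : D d -> gns_op (gadj S d) = (gns_op d)^T.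
Proof.
move=> Dd; apply/matrixP => i j; rewrite !mxE.
rewrite -lam_adj; last by apply: W2 => //; apply: M1 => //; exact: D_adj.
by rewrite gadjM gadjM !gadjK mulmxA.
Qed.

Lemma gns_vecP c a b : C a -> C b -> gns_vec (c *: a + b) = c *: gns_vec a + gns_vec b.
Proof.
move=> Ca Cb; apply/colP => i; rewrite !mxE.
rewrite -lamP; [|by apply: W2 => //; exact: (sub_span_DC D1)..]; congr (lam _).
exact: (@mulmx_linearr _ _ S _ _ l (gadj S (e i)) c a b).
Qed.

Let Csum (c : 'I_n -> R) : C (\sum_i c i *: e i).
Proof. by apply: (subspace_sum sC) => i _; exact: subspaceZ. Qed.

Lemma gns_vec_surj x : exists2 a, C a & gns_vec a = x.
Proof.
exists (\sum_i x i 0 *: e i); first exact: Csum.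
apply/colP => i; rewrite mxE.
have -> : gadj S (e i) *m (\sum_j x j 0 *: e j)
    = \sum_j x j 0 *: (gadj S (e i) *m e j : rmod S l l).
  rewrite [LHS]mulmx_sumr; apply: eq_bigr => j _; exact: rscalemxAr.
rewrite lam_sum; last by move=> j; apply: W2 => //; exact: (sub_span_DC D1).
rewrite (bigD1 i) //= orthE eqxx mulr1 big1 ?addr0 // => j /negPf ji.
by rewrite orthE eq_sym ji mulr0.
Qed.

(** The class of [d a] depends on the class of [a] only, since [I] is a left module. *)
Lemma gns_op_vec d a : D d -> C a -> gns_op d *m gns_vec a = gns_vec (d *m a).
Proof.
move=> Dd Ca; apply/colP => i; rewrite !mxE.
pose y := \sum_j lam (gadj S (e j) *m a) *: e j.
have Cy : C y by exact: Csum.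
have -> : gadj S (e i) *m (d *m a)
   = 1 *: (gadj S (e i) *m (d *m (a - y)) : rmod S l l) + gadj S (e i) *m (d *m y).
  by rewrite scale1r -!mulmxDr subrK.
have Cay : C (a - y) by exact: subspaceB.
rewrite lamP; [|by apply: W2 => //; exact: M1..].
rewrite mul1r lamI // ?add0r; [|by apply: modI; exact: basisE|exact: M1].
have -> : gadj S (e i) *m (d *m y)
    = \sum_j lam (gadj S (e j) *m a) *: (gadj S (e i) *m (d *m e j) : rmod S l l).
  rewrite mulmxA [LHS]mulmx_sumr; apply: eq_bigr => j _.
  by rewrite mulmxA; exact: rscalemxAr.
rewrite lam_sum; last by move=> j; apply: W2 => //; exact: M1.
by apply: eq_bigr => j _; rewrite !mxE mulrC.
Qed.

(** Expand [a] in the basis [e]: the remainder lies in [I] and contributes nothing by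
[lam_null_left]. *)
Lemma gns_form a d b : C a -> D d -> C b ->
  ((gns_vec a)^T *m gns_vec (d *m b)) 0 0 = lam (gadj S a *m (d *m b)).
Proof.
move=> Ca Dd Cb; rewrite mxE.
pose y := \sum_j lam (gadj S (e j) *m a) *: e j.
have Cy : C y by exact: Csum.
have Cay : C (a - y) by exact: subspaceB.
have -> : gadj S a *m (d *m b)
   = 1 *: (gadj S (a - y) *m (d *m b) : rmod S l l) + gadj S y *m (d *m b).
  by rewrite scale1r -mulmxDl -gadjD subrK.
rewrite lamP; [|by apply: W2 => //; exact: M1..].
rewrite mul1r lam_null_left // ?add0r; last exact: basisE.
have -> : gadj S y *m (d *m b)
    = \sum_j lam (gadj S (e j) *m a) *: (gadj S (e j) *m (d *m b) : rmod S l l).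
  rewrite /y gadj_sum mulmx_suml; apply: eq_bigr => j _.
  by rewrite [gadj S (_ *: _)]gadjZ -scalemxAl.
rewrite lam_sum; last by move=> j; apply: W2 => //; exact: M1.
by apply: eq_bigr => j _; rewrite !mxE.
Qed.

(** Vectors of the space on which [geval] acts are families of vectors of the space of
the representation. *)
Definition stack k (v : 'I_k -> 'cV[R]_n) : 'cV[R]_(k * n) :=
  \col_u v (mxtens_unindex u).1 (mxtens_unindex u).2 0.

Lemma stackE k (v : 'I_k -> 'cV[R]_n) i s : stack v (mxtens_index (i, s)) 0 = v i s 0.
Proof. by rewrite mxE mxtens_indexK. Qed.

Lemma stack_sum k (F : 'I_(k * n) -> R) :
  \sum_u F u = \sum_i \sum_s F (mxtens_index (i, s)).
Proof.
rewrite (reindex (@mxtens_index k n)) /=; last first.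
  by exists (@mxtens_unindex k n) => v _; rewrite (mxtens_indexK, mxtens_unindexK).
by rewrite [RHS]pair_bigA; apply: eq_bigr => -[].
Qed.

Lemma stack_dot k (v w : 'I_k -> 'cV[R]_n) :
  (stack v)^T *m stack w = \sum_i (v i)^T *m w i.
Proof.
apply/matrixP => i j; rewrite !ord1 mxE stack_sum summxE; apply: eq_bigr => u _.
by rewrite [RHS]mxE; apply: eq_bigr => s _; rewrite mxE !stackE mxE.
Qed.

Lemma geval_stack (phi : A -> 'M[R]_n) m k (q : 'M[A]_(m, k)) v :
  geval phi q *m stack v = stack (fun i => \sum_j phi (q i j) *m v j).
Proof.
apply/colP => u; case: (mxtens_indexP u) => i s.
rewrite stackE mxE stack_sum summxE; apply: eq_bigr => j _.
by rewrite mxE; apply: eq_bigr => t _; rewrite gevalE stackE.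
Qed.

Context (phi : A -> 'M[R]_n) (rphi : star_rep S phi).
Hypothesis phiD : forall d, D d -> phi (d 0 0) = gns_op d.

(** Every vector is the family of the classes of the rows of some [q], and there the
quadratic form is [lam (q^* L q)]. *)
Lemma gns_pencil_psd : psdmx (geval phi L).
Proof.
split; first by rewrite -(geval_adj rphi) symL.
move=> u; pose w s : 'cV[R]_n := \col_r u (mxtens_index (s, r)) 0.
have -> : u = stack w.
  by apply/colP => k; case: (mxtens_indexP k) => i s; rewrite stackE mxE.
have /choice[q qE] s : exists a, C a /\ gns_vec a = w s.
  by have [a] := gns_vec_surj (w s); exists a.
have Cq s : C (q s) by case: (qE s).
pose Q : rmod S nu l := \matrix_(i, j) q i 0 j.
have rowQ s : row s Q = q s by apply/rowP => j; rewrite !mxE.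
have CQ : rows_of nu C Q by move=> s; rewrite rowQ; case: (qE s).
have := lam_pencil CQ; congr (0 <= _).
rewrite -[in RHS]mulmxA geval_stack stack_dot summxE.
have -> : gadj S Q *m L *m Q
    = \sum_s 1 *: (\sum_t 1 *: (gadj S (q s) *m ((L s t)%:M *m q t) : rmod S l l)).
  rewrite -mulmxA mulmx_col_row; apply: eq_bigr => s _.
  rewrite col_gadj rowQ scale1r.
  have -> : row s (L *m Q) = \sum_t (L s t)%:M *m q t.
    apply/rowP => j; rewrite !mxE summxE; apply: eq_bigr => t _.
    by rewrite mul_scalar_mx !mxE.
  by rewrite mulmx_sumr; apply: eq_bigr => t _; rewrite scale1r.
have Wst s t : W (gadj S (q s) *m ((L s t)%:M *m q t)).
  by apply: W2; [case: (qE s) | apply: M1 => //; case: (qE t)].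
rewrite lam_sum => [|s]; last first.
  by apply: (subspace_sum sW) => t _; exact: subspaceZ.
apply: eq_bigr => s _; rewrite mul1r lam_sum // mulmx_sumr summxE.
apply: eq_bigr => t _; rewrite mul1r -gns_form //.
have opL : gns_op (L s t)%:M = phi (L s t) by rewrite -phiD // mxE eqxx mulr1n.
by rewrite (qE s).2 -gns_op_vec ?opL ?(qE t).2.
Qed.

Context (v : 'I_l -> 'cV[R]_n).
Hypothesis vE : forall c, C c -> \sum_j phi (c 0 j) *m v j = gns_vec c.

(** It suffices to consider [f = a^* d b], where the left side is the inner product of
the class of [a] with that of [d b]. *)
Lemma gns_value f : W f -> ((stack v)^T *m geval phi f *m stack v) 0 0 = lam f.
Proof.
pose mu (f : rmod S l l) := ((stack v)^T *m geval phi f *m stack v) 0 0.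
have muP c a b : mu (c *: a + b) = c * mu a + mu b.
  rewrite /mu (gevalD rphi) mulmxDr mulmxDl mxE; congr (_ + _).
  rewrite [c *: a]rscaleE -mul_scalar_mx (gevalM rphi).
  have -> : geval phi (S c)%:M = c%:M :> 'M_(l * n).
    apply/gevalP => i j s t.
    rewrite 2!mxE (can_eq (@mxtens_indexK l n)) xpair_eqE.
    have [_|_] := eqVneq i j; last by rewrite mulr0n (rep0 rphi) mxE.
    by rewrite mulr1n (rep_scal rphi) mxE.
  by rewrite mul_scalar_mx -scalemxAr -scalemxAl mxE.
suff : W `<=` [set f | W f /\ mu f = lam f] by move=> h /h[].
apply: lspan_min.
  split=> [|c a b [Wa ma] [Wb mb]].
    split; first exact: sW.1.
    have := muP (-1) 0 0; have := lamP (-1) sW.1 sW.1.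
    by rewrite scaler0 addr0 !mulN1r !addNr => -> ->.
  by split; [exact: sW.2 | rewrite muP lamP // ma mb].
move=> _ [a Ca [h Mh <-]]; split; first exact: W2.
suff : span_DC C D `<=` [set h | span_DC C D h /\ mu (gadj S a *m h) = lam (gadj S a *m h)].
  by move=> /(_ _ Mh)[].
apply: lspan_min.
  have lin c x y : gadj S a *m (c *: x + y : rmod S 1 l) =
    c *: (gadj S a *m x : rmod S l l) + gadj S a *m y.
    exact: (@mulmx_linearr _ _ S _ _ l (gadj S a) c x y).
  have s1 := span_DC_subspace C D.
  split=> [|c x y [Mx mx] [My my]].
    split; first exact: s1.1.
    rewrite mulmx0.
    have := muP (-1) 0 0; have := lamP (-1) sW.1 sW.1.
    by rewrite scaler0 addr0 !mulN1r !addNr => -> ->.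
  split; first exact: s1.2.
  by rewrite [gadj S a *m _]lin muP lamP ?mx ?my //; exact: W2.
move=> _ [d Dd [b Cb <-]]; split; first exact: M1.
rewrite /mu (gevalM rphi) (geval_adj rphi) mulmxA -trmx_mul (gevalM rphi).
rewrite -!mulmxA !geval_stack stack_dot big_ord1 big_ord1 !vE //.
by rewrite phiD // gns_op_vec // gns_form.
Qed.

End GNS.

(** The Euclidean space [C / (C /\ I)] with the compressed action [op] of [D] and the
class map [vec].  Any representation that extends [op] and reaches the classes of
[C] from a family of vectors [v] makes [L] positive and refutes the positivity of
[p]. *)
Theorem gns_representation (R : realType) (A : nzRingType) (S : star_algebra R A)
    (l nu : nat) (C I : set (rmod S 1 l)) (D : set (rmod S 1 1)) (L : 'M[A]_nu)
    (p : 'M[A]_l) :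
    subspace C -> fin_gen C -> fin_gen D -> D 1%:M ->
    (forall d, D d -> D (gadj S d)) -> (forall s t, D (L s t)%:M) -> gadj S L = L ->
    subspace I -> (forall (d : 'M[A]_1) u, I u -> I (d *m u)) ->
    (forall np nq (ps : 'I_np -> rmod S 1 l) (qs : 'I_nq -> rmod S nu l),
       (forall i, C (ps i)) -> (forall j, rows_of nu C (qs j)) ->
       null_forms C I D (\sum_i gadj S (ps i) *m ps i
                         + \sum_j gadj S (qs j) *m L *m qs j) ->
       (forall i, I (ps i)) /\ forall j, rows_of nu I (L *m qs j)) ->
    span_CDC C D p -> gadj S p = p ->
    (forall np nq (ps : 'I_np -> rmod S 1 l) (qs : 'I_nq -> rmod S nu l),
       (forall i, C (ps i)) -> (forall j, rows_of nu C (qs j)) ->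
       ~ null_forms C I D (p - (\sum_i gadj S (ps i) *m ps i
                                + \sum_j gadj S (qs j) *m L *m qs j))) ->
  exists (n : nat) (op : rmod S 1 1 -> 'M[R]_n) (vec : rmod S 1 l -> 'cV[R]_n),
    [/\ forall c d d', D d -> D d' -> op (c *: d + d') = c *: op d + op d',
        op 1%:M = 1%:M /\ forall d, D d -> op (gadj S d) = (op d)^T,
        forall c a b, C a -> C b -> vec (c *: a + b) = c *: vec a + vec b,
        forall d a, D d -> C a -> op d *m vec a = vec (d *m a)
      & forall (phi : A -> 'M[R]_n) (v : 'I_l -> 'cV[R]_n), star_rep S phi ->
          (forall d, D d -> phi (d 0 0) = op d) ->
          (forall c, C c -> \sum_j phi (c 0 j) *m v j = vec c) ->
          psdmx (geval phi L) /\ ~ psdmx (geval phi p)].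
Proof.
move=> sC fC fD D1 D_adj DL symL sI modI realI Wp symp nocert.
have [lam [lamP lam_adj lamI lam_gt0 [lam_pencil lam_p]]] :=
  separating_functional sC fC fD D1 D_adj DL symL sI realI Wp symp nocert.
have [n [e [Ce orthE basisE]]] := gns_basis sC fC D1 sI lamP lam_adj lamI lam_gt0.
exists n, (gns_op lam e), (gns_vec lam e); split.
- by move=> c d d'; exact: (gns_opP lamP Ce).
- split; first exact: gns_op1.
  by move=> d; exact: (gns_op_adj D_adj lam_adj Ce).
- by move=> c a b; exact: (gns_vecP D1 lamP Ce).
- by move=> d a; exact: (gns_op_vec sC modI lamP lamI Ce basisE).
move=> phi v rphi phiD vE; split.
  exact: (gns_pencil_psd sC D1 D_adj DL symL modI lamP lam_adj lamI lam_pencil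
            Ce orthE basisE rphi phiD).
move=> [_ /(_ (stack v))].
rewrite (gns_value sC D_adj modI lamP lam_adj lamI Ce basisE rphi phiD vE Wp).
by rewrite leNgt lam_p.
Qed.

(** * Evaluation of certificates *)

Section Soundness.
Context {R : realType} {A : nzRingType} (S : star_algebra R A) {l nu n : nat}.
Context (phi : A -> 'M[R]_n) (rphi : star_rep S phi) (L : 'M[A]_nu).
Hypothesis psdL : psdmx (geval phi L).

Let geval_form m (M : 'M[A]_m) (q : 'M[A]_(m, l)) :
  geval phi (gadj S q *m M *m q) = (geval phi q)^T *m geval phi M *m geval phi q.
Proof. by rewrite !(gevalM rphi) (geval_adj rphi). Qed.

Lemma geval_cert_psd np nq nr (ps : 'I_np -> 'M[A]_(1, l)) (qs : 'I_nq -> 'M[A]_(nu, l))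
    (rs iotas : 'I_nr -> 'M[A]_(1, l)) :
  (forall k, geval phi (iotas k) = 0) ->
  psdmx (geval phi (\sum_i gadj S (ps i) *m ps i + \sum_j gadj S (qs j) *m L *m qs j
    + \sum_k (gadj S (rs k) *m iotas k + gadj S (iotas k) *m rs k))).
Proof.
move=> i0; rewrite 2!(gevalD rphi) 3!(geval_sum rphi).
rewrite [X in _ + X]big1 ?addr0 => [|k _]; last first.
  rewrite (gevalD rphi) 2!(gevalM rphi) 2!(geval_adj rphi) i0.
  by rewrite mulmx0 trmx0 mul0mx addr0.
apply: psdmxD; apply: psdmx_sum => i.
  by rewrite (gevalM rphi) (geval_adj rphi); exact: psdmx_gram.
by rewrite geval_form; exact: psdmx_conj.
Qed.

(** The terms of a vanishing sum of positive semidefinite matrices vanish, and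
[Q^T L Q = 0] forces [L Q = 0] for a positive semidefinite [L]. *)
Lemma geval_real np nq (ps : 'I_np -> 'M[A]_(1, l)) (qs : 'I_nq -> 'M[A]_(nu, l)) :
  geval phi (\sum_i gadj S (ps i) *m ps i + \sum_j gadj S (qs j) *m L *m qs j) = 0 ->
  (forall i, geval phi (ps i) = 0) /\ (forall j, geval phi (L *m qs j) = 0).
Proof.
rewrite (gevalD rphi) 2!(geval_sum rphi) => sum0.
pose F (i : 'I_np + 'I_nq) := match i with
  | inl i => geval phi (gadj S (ps i) *m ps i)
  | inr j => geval phi (gadj S (qs j) *m L *m qs j) end.
have psdF i : psdmx (F i).
  case: i => i /=; last by rewrite geval_form; exact: psdmx_conj.
  by rewrite (gevalM rphi) (geval_adj rphi); exact: psdmx_gram.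
have F0 : \sum_i F i = 0 by rewrite big_sumType.
split=> [i|j].
  have := psdmx_sum_eq0 psdF F0 (inl i).
  rewrite /F (gevalM rphi) (geval_adj rphi) => p0.
  by apply: mxtrace_gram_eq0; rewrite p0 mxtrace0.
have := psdmx_sum_eq0 psdF F0 (inr j).
rewrite /F geval_form (gevalM rphi); exact: psdmx_conj_eq0.
Qed.

End Soundness.

(** * The free algebra *)

Section LinearMaps.
Context {R : realType}.

Lemma linear_compose (U V W : lmodType R) (f : U -> V) (h : V -> W) :
  linear f -> linear h -> linear (fun x => h (f x)).
Proof. by move=> lf lh c x y; rewrite lf lh. Qed.

Lemma linear_mull (A : lalgType R) (h : A) : linear (fun x => x * h).
Proof. by move=> c x y; rewrite mulrDl scalerAl. Qed.

Lemma linear_mulr (A : lalgType R) (h : A) :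
  (forall c a b, a * (c *: b) = c *: (a * b) :> A) -> linear (fun x : A => h * x).
Proof. by move=> AZ c x y; rewrite mulrDr AZ. Qed.

Lemma linear_mulmxl m n k (B : 'M[R]_(n, k)) : linear (fun M : 'M[R]_(m, n) => M *m B).
Proof. by move=> c x y; rewrite mulmxDl scalemxAl. Qed.

Lemma linear_mulmxr m n k (B : 'M[R]_(m, n)) : linear (fun M : 'M[R]_(n, k) => B *m M).
Proof. by move=> c x y; rewrite mulmxDr scalemxAr. Qed.

Lemma linear_trmx m n : linear (fun M : 'M[R]_(m, n) => M^T).
Proof. by move=> c x y; rewrite linearP. Qed.

End LinearMaps.

Section FreeAlgebra.
Context {R : realType} {g : nat}.
Implicit Types (f h : ncpoly R g) (w : ncword g).

Lemma malgUZ (c : R) w : << c *g w >> = c *: << w >> :> ncpoly R g.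
Proof. by apply/malgP => v; rewrite mcoeffZ !mcoeffU mulrnAr mulr1. Qed.

Section LinearExtension.
Context {V : lmodType R} (F : ncword g -> V).

Definition word_ext f : V := \sum_(w <- msupp f) f@_w *: F w.

Lemma word_extEw (d : {fset ncword g}) f : (msupp f `<=` d)%fset ->
  word_ext f = \sum_(w <- d) f@_w *: F w.
Proof.
move=> le; rewrite [LHS](big_fset_incl _ le) //= => x _ /mcoeff_outdom ->.
by rewrite scale0r.
Qed.

Lemma word_ext_linear : linear word_ext.
Proof.
move=> c f h; pose d := (msupp f `|` msupp h `|` msupp (c *: f + h))%fset.
rewrite !(@word_extEw d) ?fsubsetUr //; first last.
- by rewrite /d -fsetUA fsubsetUl.
- by rewrite /d [(msupp f `|` _)%fset]fsetUC -fsetUA fsubsetUl.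
rewrite scaler_sumr -big_split /=; apply: eq_bigr => w _.
by rewrite mcoeffD mcoeffZ scalerDl scalerA.
Qed.

Lemma word_extU w : word_ext << w >> = F w.
Proof. by rewrite (word_extEw msuppU_le) big_seq_fset1 mcoeffUU scale1r. Qed.

Lemma linear_word_ext (f : ncpoly R g -> V) :
  linear f -> (forall w, f << w >> = F w) -> f =1 word_ext.
Proof.
move=> lf fw h; have f0 := linear_at0 lf.
rewrite [h in LHS]monalgE /word_ext; elim: (enum_fset _) => [|w r IHr].
  by rewrite !big_nil.
rewrite !big_cons -IHr -fw -lf; congr (f (_ + _)).
exact: malgUZ.
Qed.

End LinearExtension.

(** Identities in the free algebra that are linear in each argument are checked on
words. *)
Lemma linear_words_eq (V : lmodType R) (f1 f2 : ncpoly R g -> V) :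
  linear f1 -> linear f2 -> (forall w, f1 << w >> = f2 << w >>) -> f1 =1 f2.
Proof.
move=> l1 l2 e12 f; rewrite (linear_word_ext l1 e12).
by rewrite (linear_word_ext l2 (fun=> erefl)).
Qed.

Lemma malgC_comm (c : R) f : f * c%:MP = c%:MP * f.
Proof.
rewrite !malgM_def fgmulgU fgmulUg; apply: eq_bigr => w _.
by rewrite mulrC mulm1 mul1m.
Qed.

Lemma mulZr (c : R) f h : f * (c *: h) = c *: (f * h).
Proof. by rewrite -!mul_malgC !mulrA malgC_comm. Qed.

Lemma malgUM w v : << w >> * << v >> = << mmul w v >> :> ncpoly R g.
Proof. by rewrite malgM_def fgmulUU mulr1. Qed.

Lemma starE f : star f = word_ext (fun w => << star_word w >> : ncpoly R g) f.
Proof. by apply: eq_bigr => w _; exact: malgUZ. Qed.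

Lemma star_linear : linear (@star R g).
Proof. by move=> c f h; rewrite !starE word_ext_linear. Qed.

Lemma starU w : star << w >> = << star_word w >> :> ncpoly R g.
Proof. by rewrite starE word_extU. Qed.

Lemma star_letterK : involutive (@star_letter g).
Proof. by case=> i b; rewrite /star_letter negbK. Qed.

Lemma star_wordK : involutive (@star_word g).
Proof.
by case=> s; rewrite /star_word /= map_rev revK -map_comp map_id_in // => a _ /=;
  rewrite star_letterK.
Qed.

Lemma star_wordM w v : star_word (mmul w v) = mmul (star_word v) (star_word w).
Proof.
apply: val_inj; rewrite -![val _]/(fmonom_val _) [RHS]fmM /= -rev_cat -map_cat.
by rewrite fmM.
Qed.

Lemma star_word1 : star_word (mone : ncword g) = mone.
Proof. by apply: val_inj; rewrite -![val _]/(fmonom_val _) /= !fm1. Qed.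

Lemma starK : involutive (@star R g).
Proof.
apply: (@linear_words_eq _ (fun f => star (star f)) id).
- exact: (linear_compose star_linear star_linear).
- by [].
- by move=> w; rewrite !starU star_wordK.
Qed.

Lemma starM f h : star (f * h) = star h * star f.
Proof.
move: f; apply: (@linear_words_eq _ (fun f => star (f * h)) (fun f => star h * star f)).
- exact: (linear_compose (@linear_mull R (ncpoly R g) h) star_linear).
- exact: (linear_compose star_linear (@linear_mulr R (ncpoly R g) (star h) mulZr)).
move=> w; move: h.
apply: (@linear_words_eq _ (fun h => star (<< w >> * h)) (fun h => star h * star << w >>)).
- exact: (linear_compose (@linear_mulr R (ncpoly R g) << w >> mulZr) star_linear).
- exact: (linear_compose star_linear (@linear_mull R (ncpoly R g) (star << w >>))).
by move=> v; rewrite malgUM !starU malgUM star_wordM.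
Qed.

Lemma starC (c : R) : star (c%:MP : ncpoly R g) = c%:MP.
Proof.
have -> : c%:MP = c *: << mone >> + 0 :> ncpoly R g by rewrite addr0; exact: malgUZ.
by rewrite star_linear (linear_at0 star_linear) starU star_word1.
Qed.

Lemma starD f h : star (f + h) = star f + star h.
Proof. by have := star_linear 1 f h; rewrite !scale1r. Qed.

Definition nc_star : star_algebra R (ncpoly R g) :=
  StarAlgebra (scal := @malgC (ncword g) R) (fun c f => malgC_comm c f)
    starD starM starK starC.

End FreeAlgebra.

Section Evaluation.
Context {R : realType} {g n : nat} (X : 'I_g -> 'M[R]_n).

Definition ev : ncpoly R g -> 'M[R]_n := word_ext (eval_word X).

Lemma ev_linear : linear ev. Proof. exact: word_ext_linear. Qed.

Lemma evU w : ev << w >> = eval_word X w.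
Proof. exact: word_extU. Qed.

Lemma eval_wordM w v : eval_word X (mmul w v) = eval_word X w *m eval_word X v.
Proof. by rewrite /eval_word fmM big_cat. Qed.

Lemma eval_word1 : eval_word X mone = 1%:M.
Proof. by rewrite /eval_word fm1 big_nil. Qed.

Lemma eval_letter_star a : eval_letter X (star_letter a) = (eval_letter X a)^T.
Proof. by case: a => i [] //=; rewrite /eval_letter /= trmxK. Qed.

Lemma eval_word_star w : eval_word X (star_word w) = (eval_word X w)^T.
Proof.
case: w => s; rewrite /eval_word /star_word /= -map_rev big_map.
elim: s => [|a s IHs]; first by rewrite !big_nil trmx1.
rewrite rev_cons -cats1 big_cat big_seq1 big_cons IHs eval_letter_star.
by rewrite [RHS]trmx_mul.
Qed.

Lemma evM (f h : ncpoly R g) : ev (f * h) = ev f *m ev h.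
Proof.
move: f; apply: (@linear_words_eq _ _ _ (fun f => ev (f * h)) (fun f => ev f *m ev h)).
- exact: (linear_compose (@linear_mull R (ncpoly R g) h) ev_linear).
- exact: (linear_compose ev_linear (@linear_mulmxl R n n n (ev h))).
move=> w; move: h.
apply: (@linear_words_eq _ _ _ (fun h => ev (<< w >> * h)) (fun h => ev << w >> *m ev h)).
- exact: (linear_compose (@linear_mulr R (ncpoly R g) << w >> mulZr) ev_linear).
- exact: (linear_compose ev_linear (@linear_mulmxr R n n n (ev << w >>))).
by move=> v; rewrite malgUM !evU eval_wordM.
Qed.

Lemma ev_star (f : ncpoly R g) : ev (star f) = (ev f)^T.
Proof.
move: f; apply: (@linear_words_eq _ _ _ (fun f => ev (star f)) (fun f => (ev f)^T)).
- exact: (linear_compose star_linear ev_linear).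
- exact: (linear_compose ev_linear (@linear_trmx R n n)).
by move=> w; rewrite starU !evU eval_word_star.
Qed.

Lemma ev0 : ev 0 = 0.
Proof. exact: linear_at0 ev_linear. Qed.

Lemma evC (c : R) : ev c%:MP = c%:M.
Proof.
have -> : c%:MP = c *: << mone >> + 0 :> ncpoly R g by rewrite addr0; exact: malgUZ.
by rewrite ev_linear ev0 addr0 evU eval_word1 scale_scalar_mx mulr1.
Qed.

Lemma ev_rep : star_rep (@nc_star R g) ev.
Proof.
split.
- by move=> a b; have := ev_linear 1 a b; rewrite !scale1r.
- exact: evM.
- exact: ev_star.
- exact: evC.
Qed.

Lemma nc_evalE m k (p : ncmx R g m k) : nc_eval X p = geval ev p.
Proof.
apply: esym; apply/gevalP => i j s t.
have sub : (msupp (p i j) `<=` mx_supp p)%fset.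
  apply/fsubsetP => w wp; apply/bigfcupP; exists i; rewrite ?mem_index_enum //.
  by apply/bigfcupP; exists j; rewrite ?mem_index_enum.
rewrite /ev (word_extEw _ sub) !summxE.
by apply: eq_bigr => w _; rewrite tensmxE !mxE.
Qed.

End Evaluation.

Lemma adjE (R : realType) (g m n : nat) (p : ncmx R g m n) : adj p = gadj nc_star p.
Proof. by []. Qed.

(** * Polynomials of degree at most one *)

Section DegreeOne.
Context {R : realType} {g : nat}.
Notation D1 := (deg_le 1 : set (ncmx R g 1 1)).

Definition letter (a : 'I_g * bool) : ncpoly R g := << FMonom [:: a] >>.

Lemma star_letter_nc a : letter (star_letter a) = sinv (@nc_star R g) (letter a).
Proof. exact: esym (starU (FMonom [:: a])). Qed.

Lemma nc_scaleE m n (c : R) (u : rmod (@nc_star R g) m n) i j :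
  (c *: u) i j = c *: (u i j : ncpoly R g).
Proof. by rewrite rscaleE mxE; exact: mul_malgC. Qed.

Lemma deg_leP m n d (p : ncmx R g m n) :
  deg_le d p <-> forall i j (w : ncword g), (d < size w)%N -> (p i j)@_w = 0.
Proof.
split=> [pd i j w dw|pd i j].
  apply/mcoeff_outdom/(@mmeasure_mnm_ge _ _ (@fdeg _)).
  exact: leq_trans (pd i j) dw.
rewrite mmeasureE; apply/bigmax_leqP_seq => w wp _.
rewrite ltnS leqNgt; apply/negP => /(pd i j)/eqP.
by rewrite mcoeff_eq0 wp.
Qed.

Lemma deg_le_subspace m n d : subspace (deg_le d : set (rmod (@nc_star R g) m n)).
Proof.
split=> [|c u v /deg_leP ud /deg_leP vd]; apply/deg_leP => i j w dw.
  by rewrite mxE mcoeff0.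
by rewrite mxE mcoeffD nc_scaleE mcoeffZ ud // vd // mulr0 addr0.
Qed.

Lemma deg_le_adj m n d (p : ncmx R g m n) : deg_le d p -> deg_le d (adj p).
Proof.
move=> /deg_leP pd; apply/deg_leP => i j w dw; rewrite !mxE /star.
rewrite raddf_sum big_seq big1 // => v vp /=; rewrite mcoeffU.
case: eqP => // vw; have := pd j i v; rewrite -vw /= size_rev size_map in dw.
by move=> -> //; rewrite mul0rn.
Qed.

Lemma mone_nil : mone = FMonom [::] :> ncword g.
Proof. by apply: val_inj; rewrite -[LHS]/(fmonom_val _) fm1. Qed.

Lemma deg_le1_words (f : ncpoly R g) : D1 f%:M ->
  f = f@_mone *: 1 + \sum_a f@_(FMonom [:: a]) *: letter a.
Proof.
move=> /deg_leP f1.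
have f0 (v : ncword g) : (1 < size v)%N -> f@_v = 0.
  by move=> /(f1 0 0); rewrite mxE eqxx mulr1n.
apply/malgP => w.
have -> : (f@_mone *: 1 + \sum_a f@_(FMonom [:: a]) *: letter a)@_w
   = f@_mone * (w == mone)%:R + \sum_a f@_(FMonom [:: a]) * (FMonom [:: a] == w)%:R.
  rewrite mcoeffD mcoeffZ mcoeff1 raddf_sum; congr (_ + _).
  by apply: eq_bigr => a _; rewrite /letter /= mcoeffZ mcoeffU1.
have eqF (s t : seq ('I_g * bool)) : (FMonom s == FMonom t) = (s == t) by [].
rewrite mone_nil; case: w => -[|a [|b s]].
- by rewrite eqxx mulr1 big1 ?addr0 // => a _; rewrite eqF mulr0.
- rewrite eqF mulr0 add0r (bigD1 a) //= eqxx mulr1 big1 ?addr0 // => b ba.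
  by rewrite eqF eqseq_cons (negPf ba) mulr0.
- rewrite f0 // eqF mulr0 add0r big1 // => c _.
  by rewrite eqF eqseq_cons andbF mulr0.
Qed.

Lemma deg_le1_1 : D1 1%:M.
Proof.
apply/deg_leP => i j w w1; rewrite !ord1 mxE eqxx mulr1n mcoeff1.
by case: eqP => // w0; move: w1; rewrite w0 fm1.
Qed.

Lemma deg_le1_letter a : D1 (letter a)%:M.
Proof.
apply/deg_leP => i j w w1; rewrite !ord1 mxE eqxx mulr1n mcoeffU.
by case: eqP => // w0; move: w1; rewrite -w0.
Qed.

Lemma deg_le1_ind (P : ncpoly R g -> Prop) :
    P 0 -> (forall c f h, P f -> P h -> P (c *: f + h)) -> P 1 ->
    (forall a, P (letter a)) -> forall f, D1 f%:M -> P f.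
Proof.
move=> P0 PD P1 Pl f /deg_le1_words ->; apply: (PD) => //.
elim/big_ind: _ => // [f1 f2 Pf1 Pf2|a _].
  by rewrite -[f1]scale1r; exact: PD.
by rewrite -[_ *: _]addr0; exact: PD.
Qed.

Lemma nc_scalarP (c : R) (f h : ncpoly R g) :
  (c *: f + h)%:M = c *: (f%:M : rmod (@nc_star R g) 1 1) + h%:M.
Proof.
rewrite raddfD; congr (_ + _).
by rewrite rscaleE scale_scalar_mx; congr (_%:M); apply: esym; exact: mul_malgC.
Qed.

Lemma deg_le1_fin_gen : fin_gen (D1 : set (rmod (@nc_star R g) 1 1)).
Proof.
pose b (a : option ('I_g * bool)) : rmod (@nc_star R g) 1 1 :=
  if a is Some a then (letter a)%:M else 1%:M.
apply: (@fin_gen_span _ _ _ b) => p.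
have sS := span_subspace b.
rewrite [p]mx11_scalar; move: (p 0 0); apply: deg_le1_ind => [|c f h Pf Ph||a].
- by rewrite raddf0; exact: sS.1.
- by rewrite nc_scalarP; exact: sS.2.
- exact: (mem_span b None).
- exact: (mem_span b (Some a)).
Qed.

End DegreeOne.

(** * Certificates and positivity *)

Section EasyDirection.
Context {R : realType} {g l nu n : nat} (X : 'I_g -> 'M[R]_n).
Context (L : ncmx R g nu nu) (C : set (ncmx R g 1 l)).

(** A sum of the form [A + B^*] with the rows of [A] and [B] in the kernel evaluates to
zero, so that [geval_real] applies. *)
Lemma eval_kernel_real : psdmx (nc_eval X L) ->
  left_module [set u : ncmx R g 1 l | nc_eval X u = 0] /\
  lc_real L C [set u : ncmx R g 1 l | nc_eval X u = 0].
Proof.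
move=> psdL; have rphi := ev_rep X; rewrite nc_evalE in psdL; split.
  split=> [|f u v]; first by rewrite /= nc_evalE (geval0 rphi).
  by rewrite /= !nc_evalE => u0 v0; rewrite (gevalD rphi) v0 addr0 (gevalZ0 rphi).
move=> np nq p q _ _ [B HB [_ [E HE <-] eqS]].
have rows0 m (M : ncmx R g m l) :
    rows_in m [set u : ncmx R g 1 l | nc_eval X u = 0] M <-> geval (ev X) M = 0.
  rewrite -(geval_rows rphi); split=> M0 i; have := M0 i; rewrite /= nc_evalE //.
have [|p0 q0] := @geval_real _ _ _ _ _ _ _ rphi _ psdL _ _ p q.
  rewrite -[X in geval _ X]eqS (gevalD rphi) (rows0 _ B).1 //.
  by rewrite [adj E]adjE (geval_adj rphi) (rows0 _ E).1 // trmx0 addr0.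
by split=> [i|j]; [rewrite /= nc_evalE; exact: p0 | apply/rows0; exact: q0].
Qed.

End EasyDirection.

Section HardDirection.
Context {R : realType} {g : nat}.
Notation S := (@nc_star R g).
Notation D1 := (deg_le 1 : set (ncmx R g 1 1)).

Lemma mulset_span_CDC l (C : set (ncmx R g 1 l)) :
  mulset (mulset (adjset C) D1) C `<=` @span_CDC R _ S l C D1.
Proof.
have sW := @span_CDC_subspace R _ S l C D1.
apply: (@lspan_min R (rmod S l l)) => // _ [x Cx [b Cb <-]]; move: x Cx.
have lin := @mulmx_linearl R _ S l 1 l b.
apply: (@lspan_min R (rmod S l 1) _ _ (preim_subspace lin sW)).
move=> _ [_ [a Ca <-] [d Dd <-]]; rewrite /preimage /= -mulmxA.
by apply: mem_span_CDC => //; exact: mem_span_DC.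
Qed.

Lemma left_module_subspace l (I : set (ncmx R g 1 l)) :
  left_module I -> subspace (I : set (rmod S 1 l)).
Proof. by move=> [I0 ID]; split=> // c u v; exact: ID. Qed.

Lemma left_module_mul l (I : set (ncmx R g 1 l)) m (d : ncmx R g m 1) u :
  left_module I -> I u -> rows_in m I (d *m u).
Proof.
move=> [I0 ID] Iu i; rewrite row_mul [row i d]mx11_scalar mul_scalar_mx.
by rewrite -[_ *: u]addr0; exact: ID.
Qed.

Lemma null_forms_sym_sum l (C I : set (ncmx R g 1 l)) : left_module I ->
  @null_forms R _ S l C I D1 `<=` sym_sum I.
Proof.
move=> mI; have sI := rows_of_subspace l (left_module_subspace mI).
apply: lspan_min.
  split=> [|c u v [a Ia [_ [b Ib <-] <-]] [a' Ia' [_ [b' Ib' <-] <-]]].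
    exists 0; first exact: sI.1.
    exists 0; last by rewrite addr0.
    by exists 0; [exact: sI.1 | exact: (@gadj0 R _ S l l)].
  exists (c%:MP *: a + a'); first exact: sI.2.
  exists (adj (c%:MP *: b + b')); first by exists (c%:MP *: b + b') => //; exact: sI.2.
  rewrite [adj _](@gadj_linear R _ S l l c b b') addrACA.
  by congr (_ + _); rewrite [RHS]scalerDr.
move=> _ [r Cr [i [Ii _] <-]]; exists (adj r *m i); first exact: left_module_mul.
exists (adj (adj r *m i)); first by exists (adj r *m i) => //; exact: left_module_mul.
by congr (_ + _); rewrite [LHS](@gadjM R _ S) [X in _ *m X](@gadjK R _ S).
Qed.

Lemma chip_span l (C : set (ncmx R g 1 l)) : right_chip_space C ->
  exists T : set ('I_l * ncword g), C = @lspan R (rmod S 1 l) [set monomial s.1 s.2 | s in T].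
Proof. by move=> [[T CT] _]; exists T; rewrite {1}CT. Qed.

Lemma finite_chip_fin_gen l (C : set (ncmx R g 1 l)) :
  finite_chip C -> fin_gen (C : set (rmod S 1 l)).
Proof.
move=> [k [b Cb]]; apply: (@fin_gen_span _ _ _ (b : 'I_k -> rmod S 1 l)).
apply: (subset_trans Cb); apply: (@lspan_min R (rmod S 1 l)).
  exact: span_subspace.
by move=> _ [i _ <-]; exact: mem_span.
Qed.

(** The coefficients of the linear combination are absorbed in the factors [r]. *)
Lemma null_forms_sum l (C I : set (ncmx R g 1 l)) (f : ncmx R g l l) :
    subspace (C : set (rmod S 1 l)) -> @null_forms R _ S l C I D1 f ->
  exists (nr : nat) (rs iotas : 'I_nr -> ncmx R g 1 l),
    [/\ forall k, C (rs k), forall k, (I `&` mulset D1 C) (iotas k)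
      & f = \sum_(k < nr) (adj (rs k) *m iotas k + adj (iotas k) *m rs k)].
Proof.
move=> sC [k [c [s [Ss ->]]]].
have /choice[r rP] i : exists r, C r /\ exists2 j, (I `&` mulset D1 C) j &
    adj r *m j + adj j *m r = s i.
  by have [r Cr [j Ij rj]] := Ss i; exists r; split=> //; exists j.
have /choice[j jP] i : exists j, (I `&` mulset D1 C) j /\
    adj (r i) *m j + adj j *m r i = s i.
  by have [_ [j Ij rj]] := rP i; exists j.
exists k, (fun i => (c i)%:MP *: r i), j; split.
- by move=> i; apply: (subspaceZ (c i) sC); case: (rP i).
- by move=> i; case: (jP i).
apply: eq_bigr => i _; rewrite -(jP i).2.
rewrite [LHS](scalerDr (c i)) /=; congr (_ + _).
  rewrite [adj (_ *: _)](@gadjZ R _ S 1 l (c i) (r i)); exact: scalemxAl.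
by apply: esym; exact: (@rscalemxAr R _ S l 1 l (c i)).
Qed.

Section Representation.
Context {l n : nat} (C : set (ncmx R g 1 l)).
Hypotheses (fullC : full_chip C) (chipC : right_chip_space C).
Context (op : rmod S 1 1 -> 'M[R]_n) (vec : rmod S 1 l -> 'cV[R]_n).
Hypotheses (opP : forall (c : R) (d d' : rmod S 1 1), D1 d -> D1 d' ->
  op (c *: d + d') = c *: op d + op d').
Hypotheses (op1 : op 1%:M = 1%:M).
Hypotheses (op_adj : forall d : rmod S 1 1, D1 d -> op (gadj S d) = (op d)^T).
Hypotheses (vecP : forall (c : R) (a b : rmod S 1 l), C a -> C b ->
  vec (c *: a + b) = c *: vec a + vec b).
Hypotheses (op_vec : forall (d : rmod S 1 1) (a : rmod S 1 l), D1 d -> C a ->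
  op d *m vec a = vec (d *m a)).

Definition gns_tuple (k : 'I_g) : 'M[R]_n := op (letter (k, false))%:M.

(** The class of [e_j]; if [e_j] is not in the full space [C], no [e_j w] is, and the
value is immaterial. *)
Definition gns_seed (j : 'I_l) : 'cV[R]_n :=
  if pselect (C (monomial j mone)) then vec (monomial j mone) else 0.

Lemma eval_letter_op a : eval_letter gns_tuple a = op (letter a)%:M.
Proof.
case: a => k [] //; rewrite /eval_letter /= /gns_tuple.
rewrite -op_adj; last exact: deg_le1_letter.
by rewrite gadj_scalar -star_letter_nc.
Qed.

Lemma ev_op d : D1 d -> ev gns_tuple (d 0 0) = op d.
Proof.
move=> Dd; rewrite [d in op d]mx11_scalar.
rewrite [d]mx11_scalar in Dd; move: (d 0 0) Dd => f Df.
suff [] : D1 f%:M /\ ev gns_tuple f = op f%:M by [].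
have sD := @deg_le_subspace R g 1 1 1.
have op0 : op 0 = 0.
  by have := opP (-1) sD.1 sD.1; rewrite scaler0 addr0 scaleN1r addNr.
move: f Df; apply: deg_le1_ind => [|c f h [Df ef] [Dh eh]||a].
- by rewrite raddf0 ev0 op0; split=> //; exact: sD.1.
- rewrite nc_scalarP.
  by split; [exact: sD.2 | rewrite ev_linear opP // ef eh].
- by split; [exact: deg_le1_1 | rewrite op1 -(evC gns_tuple 1)].
- split; first exact: deg_le1_letter.
  by rewrite evU /eval_word big_seq1 eval_letter_op.
Qed.

(** Peeling off the letters of [w] from the left, fullness keeps every suffix in [C],
where [op] acts as the multiplication. *)
Lemma eval_word_seed i w : C (monomial i w) ->
  eval_word gns_tuple w *m gns_seed i = vec (monomial i w).
Proof.
case: w; elim=> [|a s IHs] Cs.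
  rewrite -mone_nil in Cs *; rewrite eval_word1 mul1mx /gns_seed.
  by case: pselect.
have w2 : FMonom (a :: s) = mmul (FMonom [:: a]) (FMonom s) :> ncword g.
  by apply: val_inj; rewrite -[RHS]/(fmonom_val _) fmM.
have Cs' : C (monomial i (FMonom s)) by apply: (fullC (w1 := FMonom [:: a])); rewrite -w2.
rewrite w2 eval_wordM -mulmxA IHs // /eval_word big_seq1 eval_letter_op.
rewrite op_vec //; last exact: deg_le1_letter.
by rewrite mul_scalar_mx /monomial scalerA /letter malgUM.
Qed.

Lemma ev_seed c : C c -> \sum_j ev gns_tuple (c 0 j) *m gns_seed j = vec c.
Proof.
have [T CT] := chip_span chipC.
have sC : subspace (C : set (rmod S 1 l)) by rewrite CT; exact: lspan_subspace.
have vec0 : vec 0 = 0.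
  by have := vecP (-1) sC.1 sC.1; rewrite scaler0 addr0 scaleN1r addNr.
have CTm s : T s -> C (monomial s.1 s.2).
  by move=> Ts; rewrite CT; apply: (@sub_lspan R (rmod S 1 l)); exists s.
suff : C `<=` [set c | C c /\ \sum_j ev gns_tuple (c 0 j) *m gns_seed j = vec c].
  by move=> h /h[].
rewrite {1}CT; apply: (@lspan_min R (rmod S 1 l)).
  split=> [|d a b [Ca ea] [Cb eb]].
    split; first exact: sC.1.
    by rewrite vec0 big1 // => j _; rewrite mxE ev0 mul0mx.
  split; first exact: sC.2.
  rewrite vecP // -ea -eb scaler_sumr -big_split /=; apply: eq_bigr => j _.
  have -> : (d *: a + b) 0 j = d *: a 0 j + b 0 j.
    by rewrite mxE; congr (_ + _); exact: nc_scaleE.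
  by rewrite ev_linear mulmxDl scalemxAl.
move=> _ [[i w] Ts <-]; have /= Cm := CTm _ Ts; split=> //=.
rewrite (bigD1 i) //= [X in _ + X]big1 ?addr0 => [|j /negPf ji]; last first.
  by rewrite mxE mxE ji andbF mulr0 ev0 mul0mx.
by rewrite mxE mxE !eqxx mulr1 evU eval_word_seed.
Qed.

End Representation.
End HardDirection.

Theorem corollary4p3 (R : realType) (g l nu : nat)
    (C : set (ncmx R g 1 l)) (L : ncmx R g nu nu) (p : ncmx R g l l)
    (chipC : right_chip_space C) (fullC : full_chip C) (finC : finite_chip C)
    (pencilL : linear_pencil L)
    (p_in : mulset (mulset (adjset C) (deg_le 1 : set (ncmx R g 1 1))) C p)
    (symp : nc_symmetric p) :
  (forall (n : nat) (X : 'I_g -> 'M[R]_n),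
     psdmx (nc_eval X L) -> psdmx (nc_eval X p))
  <->
  (exists (np nq nr : nat)
     (ps : 'I_np -> ncmx R g 1 l) (qs : 'I_nq -> ncmx R g nu l)
     (rs iotas : 'I_nr -> ncmx R g 1 l),
     [/\ forall i, C (ps i),
         forall j, rows_in nu C (qs j),
         forall k, C (rs k),
         forall k, (lc_radical L C [set 0]
                    `&` mulset (deg_le 1 : set (ncmx R g 1 1)) C) (iotas k)
       & p = \sum_(i < np) adj (ps i) *m ps i
             + \sum_(j < nq) adj (qs j) *m L *m qs j
             + \sum_(k < nr) (adj (rs k) *m iotas k + adj (iotas k) *m rs k)]).
Proof.
split=> [pos|]; last first.
  move=> [np [nq [nr [ps [qs [rs [iotas [Cps Cqs Crs Iiotas ->]]]]]]]] n X psdL.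
  have kerI k : geval (ev X) (iotas k) = 0.
    have [I_ _] := Iiotas k; rewrite -nc_evalE.
    apply: (I_ [set u | nc_eval X u = 0]); split; first exact: eval_kernel_real.
    by move=> _ ->; rewrite /= nc_evalE (geval0 (ev_rep X)).
  rewrite nc_evalE in psdL; rewrite nc_evalE.
  exact: (geval_cert_psd (ev_rep X) psdL ps qs rs kerI).
apply: contrapT => nocert.
pose S := @nc_star R g; pose I := lc_radical L C [set 0].
have [mI realI] : left_module I /\ lc_real L C I by exact: lc_radicalP.
have [T CT] := chip_span chipC.
have sC : subspace (C : set (rmod S 1 l)) by rewrite CT; exact: lspan_subspace.
have [symL degL] := pencilL.
have DL s t : (deg_le 1 : set (ncmx R g 1 1)) (L s t)%:M.
  by move=> i j; rewrite !ord1 mxE eqxx mulr1n.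
have := @gns_representation R _ S l nu C I (deg_le 1) L p sC (finite_chip_fin_gen finC)
  deg_le1_fin_gen deg_le1_1 (@deg_le_adj R g 1 1 1) DL (esym symL)
  (left_module_subspace mI).
case.
- move=> d u Iu; have := left_module_mul d mI Iu 0.
  by rewrite [row 0 _](_ : _ = d *m u) //; apply/rowP => j; rewrite mxE.
- move=> np nq ps qs Cps Cqs Jf; apply: realI Cps Cqs _.
  exact: (null_forms_sym_sum mI Jf).
- exact: mulset_span_CDC.
- exact: esym symp.
- move=> np nq ps qs Cps Cqs /(null_forms_sum sC)[nr [rs [iotas [Crs Ii pE]]]].
  apply: nocert; exists np, nq, nr, ps, qs, rs, iotas; split=> //.
  by rewrite -pE addrC subrK.
move=> n [op [vec [opP [op1 op_adj] vecP op_vec contra]]].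
pose X := gns_tuple op.
have [psdL npsdp] := contra (ev X) (gns_seed C vec) (ev_rep X)
  (ev_op opP op1 op_adj) (ev_seed fullC chipC op_adj vecP op_vec).
by apply: npsdp; rewrite -nc_evalE; apply: pos; rewrite nc_evalE.
Qed.
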